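(* Let $c, d_1, d_2$ be integers greater than $1$ such that $c$ is odd and $d_1, d_2$ are coprime with $c$. Let $N$ be the number of solutions $(X,Y,z)$ to the equation $$X + Y = c^z,$$ where $z \in \mathbb{Z}$, $X = d_1^{x_1} d_2^{x_2}$, $Y = d_1^{y_1} d_2^{y_2}$ for some integers $x_1,x_2,y_1,y_2$ with $\max(x_i,y_i) > 0$ and $\min(x_i,y_i) = 0$ for $i = 1,2$, and $X < Y$. Then $N \le 2$, except for the following choices of $(d_1,d_2,c)$, where the labelling is taken so that $d_1 > d_2$: $(3,2,5)$, $(5,2,3)$, and $(2^{g-1}-1,\, 2,\, 2^g - 1)$ with $g > 2$ an integer. Each of these cases gives exactly three solutions (listed up to the order of the two summands), as follows: - $(d_1,d_2,c) = (3,2,5)$: $\ 3 + 2 = 5$, $\ 3\cdot 2^3 + 1 = 5^2$, $\ 3^2 + 2^4 = 5^2$. - $(d_1,d_2,c) = (5,2,3)$: $\ 5 + 2^2 = 3^2$, $\ 5\cdot 2^4 + 1 = 3^4$, $\ 5^2 + 2 = 3^3$. - $(d_1,d_2,c) = (2^{g-1}-1, 2, 2^g-1)$: $\ (2^{g-1}-1) + 2^{g-1} = 2^g - 1$, $\ 2^{g+1}(2^{g-1}-1) + 1 = (2^g-1)^2$, $\ 2(2^{g-1}-1) + 1 = 2^g - 1$. *)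

(* Defs.v *)
(* MathComp world, with the classical sets and cardinality of
   mathcomp-classical. *)
From HB Require Import structures.
From mathcomp Require Import all_boot all_order all_algebra.
From mathcomp Require Import boolp classical_sets functions cardinality.

Set Implicit Arguments.
Unset Strict Implicit.
Unset Printing Implicit Defensive.

Import Order.TTheory GRing.Theory Num.Theory.

Local Open Scope classical_set_scope.
Local Open Scope ring_scope.

(* All exponents are arbitrary integers, so the powers are taken in rat: in
   int, a nonunit c satisfies c^-1 = c by convention, and a negative z would
   create spurious solutions of X + Y = c ^ z.  A solution is the triple
   (X, Y, z); the exponents of d1 and d2 are only asserted to exist, since
   they need not be unique when d1 and d2 are multiplicatively dependent. *)
Definition solutions (d1 d2 c : int) : set (int * int * int) :=
  [set t | let: (X, Y, z) := t in
    [/\ X%:~R + Y%:~R = c%:~R ^ z :> rat,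
        exists x1 x2 y1 y2 : int,
          [/\ X%:~R = d1%:~R ^ x1 * d2%:~R ^ x2 :> rat,
              Y%:~R = d1%:~R ^ y1 * d2%:~R ^ y2 :> rat,
              0 < Num.max x1 y1 /\ Num.min x1 y1 = 0 &
              0 < Num.max x2 y2 /\ Num.min x2 y2 = 0]
      & X < Y]].

Definition exceptional (d1 d2 c : int) : Prop :=
  [\/ (d1, d2, c) = (3, 2, 5),
      (d1, d2, c) = (5, 2, 3)
    | exists2 g : nat, (2 < g)%N
        & (d1, d2, c) = (2 ^+ (g - 1) - 1, 2, 2 ^+ g - 1)].

(* Main.v *)
Require Import Defs.
From HB Require Import structures.
From mathcomp Require Import all_boot all_order all_algebra.
From mathcomp Require Import boolp classical_sets functions cardinality.
From mathcomp Require Import zify ring.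

Set Implicit Arguments.
Unset Strict Implicit.
Unset Printing Implicit Defensive.

Import Order.TTheory GRing.Theory Num.Theory.

Local Open Scope classical_set_scope.
Local Open Scope card_scope.
Local Open Scope ring_scope.

(** Write d, e for the two bases.  A solution X + Y = c ^ z has X / Y = d ^ u * e ^ v
    for a pair w = (u, v) of nonzero integers, and since X = - Y modulo c, the
    homomorphism g (u, v) = d ^ u * e ^ v from pairs to the units of Z / c takes the
    value -1 at w.  Let L be the group of pairs where g is 1 or -1.  It has rank at
    most 2, so L / 2L has at most four elements; g is 1 on 2L, hence g = -1 on at most
    two of them.  Among three solutions, two therefore have w + w' in 2L: they are in
    the same class ([same_class_pigeonhole]).  So the theorem reduces to two questions:
    when can one class contain two solutions, and what else happens then.

    Two solutions of one class.  Write X Y = D e ^ 2 and X' Y' = D f ^ 2.  The element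
    (sqrt X + sqrt (- Y)) ^ 2 = X - Y + e sqrt (- 4 D) has norm c ^ (2 z), and being in
    the same class says that the two elements so obtained are divisible by powers of
    the same ideal of norm c.  Euclid's algorithm on the exponents makes both of them,
    up to sign, powers w ^ t and w ^ s of one element, with t and s coprime
    ([aligned_common_root]).  The products X Y and X' Y' have the same prime
    divisors, so the imaginary parts of w ^ t and w ^ s have no prime divisor outside
    those of 4 D and of the imaginary part of w.  For an odd exponent n, writing
    (sqrt X + sqrt (- Y)) ^ n = P sqrt X + Q sqrt (- Y), this forces the primes of P and
    Q to divide n, so that P and Q are too small unless n = 3; an even exponent must
    be 2 ([radical_stable_odd], [radical_stable_even]).  The outcome
    ([same_class_powers]) is that the second solution is the double of the first,
    (X - Y) ^ 2 + 4 X Y with X - Y = 1 or -1, or its triple, where {X, Y} = {x, 3 x + 1}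
    and 8 x + 3 is a power of 3.

    The bases.  A triple forces 3 + 10 = 13 and 3 ^ 7 + 10 = 13 ^ 3.  A double makes a
    power of d and a power of e consecutive, and 4 = e ^ n for some n, so e is 2 or 4;
    the elementary cases of Catalan's equation leave d = 2 ^ h + 1 or 2 ^ h - 1 with
    c = 2 ^ (h + 1) + 1 or 2 ^ (h + 1) - 1, and two sporadic choices of (d, c)
    ([special_bases]).

    The special bases.  For each of them all solutions are found.  Either the
    pigeonhole applied to a new solution and two known ones suffices, or the new
    solution must lie outside the class of a known one; its exponents then have a
    prescribed parity, and congruences exclude it. *)

(** * Integers: primes, powers and congruences *)

Lemma PoszX (m n : nat) : (m ^ n)%N%:Z = m%:Z ^+ n.
Proof. by rewrite -[LHS]natz natrX natz. Qed.

Lemma sqr_normz (a : int) : `|a| ^+ 2 = a ^+ 2.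
Proof. by rewrite real_normK ?num_real. Qed.

Lemma dvdz_norm_nat (q n : nat) (b : int) : `|b| = n%:Z ->
  (q %| b)%Z = (q %| n)%N.
Proof. by move=> bn; rewrite dvdzE; congr (_ %| _)%N; lia. Qed.

Lemma prime_dvdzM (q : nat) (a b : int) : prime q ->
  (q %| a * b)%Z -> (q %| a)%Z \/ (q %| b)%Z.
Proof.
by move=> pq; rewrite !dvdzE abszM Euclid_dvdM // => /orP.
Qed.

Lemma prime_dvdzX (q : nat) (a : int) n : prime q ->
  (q %| a ^+ n)%Z -> (q %| a)%Z.
Proof.
by move=> pq; rewrite !dvdzE abszX Euclid_dvdX // => /andP[].
Qed.

Lemma leq_only_prime_factor (p n : nat) : (0 < n)%N -> (0 < p)%N ->
  (forall q, prime q -> q %| n -> q = p)%N -> ~~ (p ^ 2 %| n)%N -> (n <= p)%N.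
Proof.
move=> n0 p0 Hn; apply: contraNT; rewrite -ltnNge => pn.
have n1 : (1 < n)%N by lia.
have pv := pdiv_dvd n; have ed := Hn _ (pdiv_prime n1) pv.
rewrite {}ed in pv.
case/dvdnP: pv => k nk; rewrite nk in n0 n1 pn Hn *.
have k1 : (1 < k)%N by case: (k) pn => [|[|]] //; rewrite ?mul1n ?ltnn.
have kv : (pdiv k %| k * p)%N by rewrite dvdn_mulr // pdiv_dvd.
have pk : (p %| k)%N by rewrite -(Hn _ (pdiv_prime k1) kv) pdiv_dvd.
by rewrite expnS expn1 dvdn_mul.
Qed.

Lemma pow_only_prime_factor (p n : nat) : (0 < n)%N ->
  (forall q, prime q -> q %| n -> q = p)%N -> exists e, n = (p ^ e)%N.
Proof.
move=> n0 Hn; have : p.-nat n.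
  apply/pnatP => // q pq qn; exact/eqP/Hn.
by case/p_natP => e ->; exists e.
Qed.

(** Two numbers with a square product are in the same class modulo squares; dividing m and
    s by their gcd leaves e and f, and g is what remains. *)
Lemma square_mul_common (m n s : nat) : (0 < m)%N -> (s ^ 2 = m * n)%N ->
  exists g e f, [/\ m = g * e ^ 2, n = g * f ^ 2 & s = g * e * f]%N.
Proof.
move=> m0 smn; have k0 : (0 < gcdn m s)%N by rewrite gcdn_gt0 m0.
have mE := divnK (dvdn_gcdl m s); have sE := divnK (dvdn_gcdr m s).
have co : coprime (m %/ gcdn m s) (s %/ gcdn m s).
  by rewrite /coprime -(eqn_pmul2r k0) mul1n muln_gcdl mE sE.
move: (gcdn m s) (m %/ _)%N (s %/ _)%N => k e f in k0 mE sE co *.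
have kf : (k * f ^ 2 = e * n)%N.
  apply/eqP; rewrite -(eqn_pmul2l k0); apply/eqP.
  by move: smn; rewrite -mE -sE; rewrite -!mulnn => H; nia.
have /dvdnP[g kE] : (e %| k)%N.
  by rewrite -(@Gauss_dvdl e k (f ^ 2)) ?coprimeXr // kf dvdn_mulr.
have e0 : (0 < e)%N by rewrite lt0n; apply: contraTneq m0 => e0; rewrite -mE e0.
exists g, e, f; split; [by rewrite -mE kE; ring| |by rewrite -sE kE; ring].
by apply/eqP; rewrite -(eqn_pmul2l e0) -kf kE; apply/eqP; ring.
Qed.

Lemma expn_eq_prime (c z p : nat) : (1 < c)%N -> prime p -> (c ^ z = p)%N ->
  c = p /\ z = 1%N.
Proof.
move=> c1 pp cz; have z0 : (0 < z)%N by case: z cz => // p1; rewrite -p1 in pp.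
have : (c %| p)%N by rewrite -cz -(prednK z0) expnS dvdn_mulr.
have [_ H] := primeP pp; move/H => /orP[/eqP c1'|/eqP cp]; first by rewrite c1' in c1.
split=> //; apply/eqP; rewrite -(eqn_exp2l _ _ c1) cz expn1; exact/eqP.
Qed.

Lemma expn_eq_small (e b n : nat) : (1 < e)%N -> (0 < b)%N -> (e ^ b = n)%N ->
  b = 1%N /\ e = n \/ exists k, n = (e * e * k)%N.
Proof.
move=> e1 b0 eb; case: b b0 eb => [|[|b]] //= _ eb.
  by left; rewrite -eb expn1.
by right; exists (e ^ b)%N; rewrite -eb !expnS mulnA.
Qed.

(** The two powers of e are mutually divisible by Gauss's lemma, hence equal. *)
Lemma mul_pow_cancel (d e n a b a' b' : nat) : (0 < d)%N -> (0 < e)%N ->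
  coprime e d -> coprime e n -> (d ^ a' * e ^ b' = n * (d ^ a * e ^ b))%N ->
  (d ^ a' = n * d ^ a)%N.
Proof.
move=> d0 e0 ed en E.
have eb : (e ^ b' = e ^ b)%N.
  apply/eqP; rewrite eqn_dvd; apply/andP; split.
    rewrite -(@Gauss_dvdr _ (n * d ^ a)); last first.
      by rewrite coprimeMr !coprimeXl ?coprimeXr.
    by rewrite -mulnA -E dvdn_mull.
  rewrite -(@Gauss_dvdr _ (d ^ a')); last by rewrite coprimeXl ?coprimeXr.
  by rewrite E mulnA dvdn_mull.
by apply/eqP; rewrite -(@eqn_pmul2r (e ^ b)) ?expn_gt0 ?e0 // -mulnA -E eb.
Qed.

Lemma modn_expn_period (m x k n : nat) : (x ^ k = 1 %[mod m])%N ->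
  (x ^ n = x ^ (n %% k) %[mod m])%N.
Proof.
move=> xk; rewrite {1}(divn_eq n k) mulnC expnD expnM -modnMml -modnXm xk.
by rewrite modnXm exp1n modnMml mul1n.
Qed.

(** * The powers of two next to a perfect power *)

(** For s = 1 or -1, a number d odd and an odd exponent, d ^ n - s is d - s times a sum
    of an odd number of odd terms. *)
Lemma odd_pow_sub_sign (d s : int) (k : nat) : s ^+ 2 = 1 -> (exists j, d = 2 * j + 1) ->
  exists j : int, d ^+ k.*2.+1 - s = (d - s) * (2 * j + 1).
Proof.
move=> s2 [v dv]; elim: k => [|k [j IH]]; first by exists 0; rewrite mulr0 add0r mulr1.
have [t st] : exists t, s = 2 * t + 1.
  have s1 : s = 1 \/ s = -1 by clear -s2; nia.
  by case: s1 => ->; [exists 0 | exists (-1)].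
exists (2 * v ^+ 2 * (2 * j + 1) + 2 * v * (2 * j + 1) + j + 1 + 2 * t * v + t + v).
have -> : d ^+ k.+1.*2.+1 = d ^+ 2 * (d ^+ k.*2.+1 - s) + d ^+ 2 * s.
  by rewrite -[k.+1.*2.+1]/(2 + k.*2.+1)%N exprD; ring.
rewrite IH.
have -> : d ^+ 2 * ((d - s) * (2 * j + 1)) + d ^+ 2 * s - s =
  d ^+ 2 * ((d - s) * (2 * j + 1)) + d ^+ 2 * s - s * 1 by ring.
rewrite -[X in s * X]s2.
transitivity ((d - s) * (d ^+ 2 * (2 * j + 1) + s * d + s ^+ 2)); first ring.
by congr (_ * _); rewrite s2 dv st; ring.
Qed.

Lemma odd_dvd_pow2 (q h : nat) : odd q -> (q %| 2 ^ h)%N -> q = 1%N.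
Proof.
move=> oq qh; have : coprime q (2 ^ h) by rewrite coprimeXr // coprimen2.
by rewrite /coprime (gcdn_idPl qh) => /eqP.
Qed.

(** The cofactor of d - s in d ^ a - s is odd and divides a power of 2, so it is 1. *)
Lemma pow2_neighbor_odd (d a h : nat) (s : int) : odd d -> (1 < d)%N -> odd a ->
  s ^+ 2 = 1 -> d%:Z ^+ a = 2 ^+ h + s -> a = 1%N.
Proof.
move=> od d1 oa s2 E.
have dj : exists j, d%:Z = 2 * j + 1.
  by exists (d./2%:Z); rewrite -{1}(odd_double_half d) od; clear; lia.
have [j] := odd_pow_sub_sign a./2 s2 dj.
have -> : a./2.*2.+1 = a by rewrite -[RHS]odd_double_half oa.
move=> Ej; have Eh : 2 ^+ h = (d%:Z - s) * (2 * j + 1) by rewrite -Ej E addrK.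
have q1 : `|(2 * j + 1)%R|%N = 1%N.
  apply: (@odd_dvd_pow2 _ h); first by clear; lia.
  have : (2 * j + 1 %| 2 ^+ h)%Z by rewrite Eh dvdz_mull.
  by rewrite dvdzE abszX.
have s1 : s = 1 \/ s = -1 by clear -s2; nia.
have [q|q] : 2 * j + 1 = 1 \/ 2 * j + 1 = -1 by clear -q1; lia.
  have : d%:Z ^+ a = d%:Z ^+ 1.
    by rewrite E Eh q; ring.
  by apply: ieexprIn; [clear -d1; lia | apply/eqP; clear -d1; lia].
have : (0 : int) < 2 ^+ h by rewrite exprn_gt0.
by rewrite Eh q; clear -d1 s1; lia.
Qed.

Lemma pow2_split (m n h : nat) : (m * n = 2 ^ h)%N ->
  exists i j, m = (2 ^ i)%N /\ n = (2 ^ j)%N.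
Proof.
move=> E; have /(dvdn_pfactor _ _ (isT : prime 2))[i _ mE] : (m %| 2 ^ h)%N.
  by rewrite -E dvdn_mulr.
have /(dvdn_pfactor _ _ (isT : prime 2))[j _ nE] : (n %| 2 ^ h)%N.
  by rewrite -E dvdn_mull.
by exists i, j.
Qed.

Lemma odd_pow2 (t : nat) : odd (2 ^ t) -> (2 ^ t = 1)%N.
Proof. by rewrite oddX orbF => /eqP->. Qed.

(** Of the two factors n - m and n + m of the power of 2, one is exactly 2, because n
    and m are odd. *)
Lemma square_diff_pow2 (m n h : nat) : odd m -> odd n -> (n ^ 2 = m ^ 2 + 2 ^ h)%N ->
  exists t, n = (2 ^ t).+1 /\ (m.+1 = 2 ^ t)%N.
Proof.
move=> om on E; have mn : (m < n)%N.
  by rewrite -(ltn_exp2r m n (isT : 0 < 2)%N) E -addn1 leq_add2l expn_gt0.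
pose p := ((n - m)./2)%N; pose r := ((n + m)./2)%N.
have pE : (n = p + r)%N by rewrite /p /r; clear -om on mn; lia.
have rE : (r = m + p)%N by rewrite /p /r; clear -om on mn; lia.
have p0 : (0 < p)%N by rewrite /p; clear -om on mn; lia.
have E4 : (4 * (p * r) = 2 ^ h)%N by move: E; rewrite pE rE -!mulnn; clear; nia.
have h2 : (1 < h)%N.
  by case: h E E4 => [|[|h]] // _; rewrite ?expn0 ?expn1; clear; lia.
have /pow2_split[i [j [pi rj]]] : (p * r = 2 ^ (h - 2))%N.
  apply/eqP; rewrite -(eqn_pmul2l (isT : 0 < 4)%N) E4; apply/eqP.
  by rewrite -{1}(subnKC h2) expnD.
have p1 : p = 1%N.
  have [op|ep] := boolP (odd p); first by rewrite pi odd_pow2 // -pi.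
  have r1 : r = 1%N.
    have : odd r by move: on; rewrite pE oddD (negPf ep).
    by move=> o; rewrite rj odd_pow2 // -rj.
  by move: om rE; rewrite r1; clear -p0; lia.
by exists j; rewrite -rj; split; [rewrite pE p1 | rewrite rE p1 addn1].
Qed.

(** The case 2 ^ h + 1 of Catalan's equation: an even exponent a factors 2 ^ h as a
    difference of squares, and only 9 = 8 + 1 survives. *)
Lemma pow2_succ_power (d a h : nat) : (1 < d)%N -> (0 < h)%N -> (d ^ a = (2 ^ h).+1)%N ->
  a = 1%N \/ [/\ d = 3, a = 2 & h = 3]%N.
Proof.
move=> d1 h0 E; have oX : odd (d ^ a).
  by rewrite E /= oddX negb_or -lt0n h0.
have a0 : (0 < a)%N.
  by case: a E {oX} => // /eqP; rewrite expn0 eqSS eq_sym expn_eq0.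
have od : odd d by move: oX; rewrite oddX (gtn_eqF a0).
have [oa|ea] := boolP (odd a).
  left; apply: (@pow2_neighbor_odd d a h 1) => //.
  by rewrite -PoszX E -addn1 PoszD PoszX.
right; have aE : a = (a./2 * 2)%N by rewrite muln2 even_halfK.
have [|//||t [dE t1]] := @square_diff_pow2 1 (d ^ a./2) h; first by [].
- by rewrite oddX od orbT.
- by rewrite -expnM -aE E addnC addn1.
have t1' : t = 1%N.
  by apply/eqP; rewrite -(eqn_exp2l _ _ (isT : 1 < 2)%N) -t1.
move: dE; rewrite t1' => /(expn_eq_prime d1 (isT : prime 3))[d3 a2].
have h3 : (2 ^ h = 2 ^ 3)%N by move: E; rewrite aE d3 a2 => -[].
split=> //; first by rewrite aE a2.
by apply/eqP; rewrite -(eqn_exp2l _ _ (isT : 1 < 2)%N) h3.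
Qed.

(** The case 2 ^ h - 1 of Catalan's equation: an even exponent is excluded modulo 4. *)
Lemma pow2_pred_power (d a h : nat) : (1 < d)%N -> (0 < a)%N ->
  ((d ^ a).+1 = 2 ^ h)%N -> a = 1%N.
Proof.
move=> d1 a0 E; have da : (1 < d ^ a)%N by rewrite -(expn0 d) ltn_exp2l.
have h2 : (1 < h)%N.
  by case: h E => [|[|h]] //; move: da; rewrite ?expn0 ?expn1; clear; lia.
have h4 : (2 ^ h = 4 * 2 ^ (h - 2))%N by rewrite -{1}(subnKC h2) expnD.
have oX : odd (d ^ a) by move: E; rewrite h4; clear; move: (d ^ a)%N => k; lia.
have od : odd d by move: oX; rewrite oddX (gtn_eqF a0).
have [oa|ea] := boolP (odd a).
  apply: (@pow2_neighbor_odd d a h (-1)) => //.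
  by rewrite -PoszX -[2]/(2%N%:Z) -PoszX -E -addn1 PoszD addrK.
have aE : a = (a./2 * 2)%N by rewrite muln2 even_halfK.
exfalso; move: E; rewrite h4 aE expnM.
have : odd (d ^ a./2) by rewrite oddX od orbT.
by move: (d ^ _)%N (2 ^ _)%N => k l; clear; rewrite -mulnn; nia.
Qed.

(** A common divisor of n and d divides 2 and is odd. *)
Lemma coprime_of_dvd_shift2 (d m n : nat) : odd d -> (d %| m)%N ->
  (n = m + 2 \/ m = n + 2)%N -> coprime n d.
Proof.
move=> od dm H; have g2 : (gcdn n d %| 2)%N.
  have gm : (gcdn n d %| m)%N by apply: dvdn_trans dm; exact: dvdn_gcdr.
  have gn := dvdn_gcdl n d; case: H => E.
    by rewrite -(dvdn_addr _ gm) -E.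
  by rewrite -(dvdn_addr _ gn) -E.
apply/eqP; apply: (@odd_dvd_pow2 _ 1) => //.
by apply: dvdn_odd od; exact: dvdn_gcdr.
Qed.

(** 2 ^ h is -1 modulo 2 ^ h + 1, so subtracting h from b changes the sign of s; once
    b < h the divisor exceeds the number it divides. *)
Lemma pow2_mod_order (h b : nat) (s : int) : (0 < h)%N -> `|s| = 1 ->
  ((2 ^ h + 1)%N%:Z %| (2 ^ b)%N%:Z - s)%Z -> (h %| b)%N.
Proof.
move=> h0; have [n] := ubnP b; elim: n b s => // n IHn b s bn s1 H.
have [hb|bh] := leqP h b.
  rewrite -(subnK hb) dvdn_addl //; apply: (IHn _ (- s)); rewrite ?normrN //.
    by clear -hb h0 bn; lia.
  have -> : (2 ^ (b - h))%N%:Z - - s =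
     (2 ^ (b - h))%N%:Z * (2 ^ h + 1)%N%:Z - ((2 ^ b)%N%:Z - s).
    have -> : (2 ^ b = 2 ^ (b - h) * 2 ^ h)%N by rewrite -expnD subnK.
    by rewrite PoszD PoszM; ring.
  by rewrite rpredB // dvdz_mull.
case: b bh H {bn} => [|b] bh; first by rewrite dvdn0.
have lt : (2 ^ b.+1 < 2 ^ h)%N by rewrite ltn_exp2l.
have p : (0 < 2 ^ b)%N by rewrite expn_gt0.
move=> /dvdzP[q E]; exfalso; move: lt p E; rewrite expnS.
move: (2 ^ h)%N (2 ^ b)%N q s1 => k l q s1 lt p E.
have q0 : q = 0 by clear -s1 lt p E; nia.
by rewrite q0 in E; clear -E s1 p; lia.
Qed.

(** * The rings of integers extended by a square root of a negative integer *)

(** The order Z[sqrt (- E)]; the pair (a, b) stands for a + b sqrt (- E).  The parameter E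
    only serves to select the multiplication. *)
Definition quad (E : int) : Type := (int * int)%type.

Section QuadRing.
Variable E : int.
HB.instance Definition _ := GRing.Zmodule.copy (quad E) (int * int)%type.
Implicit Types x y : quad E.
Definition quad_one : quad E := (1, 0).
Definition quad_mul x y : quad E :=
  (x.1 * y.1 - E * x.2 * y.2, x.1 * y.2 + x.2 * y.1).

Fact quad_mulA : associative quad_mul.
Proof. by move=> x y z; rewrite /quad_mul; congr pair => /=; ring. Qed.

Fact quad_mulC : commutative quad_mul.
Proof. by move=> x y; rewrite /quad_mul; congr pair => /=; ring. Qed.

Fact quad_mul1 : left_id quad_one quad_mul.
Proof. by case=> a b; rewrite /quad_mul; congr pair => /=; ring. Qed.

Fact quad_mulD : left_distributive quad_mul +%R.
Proof.
by move=> [a b] [a' b'] z; rewrite /quad_mul; congr pair => /=; ring.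
Qed.

Fact quad_one_neq0 : quad_one != 0. Proof. by []. Qed.

HB.instance Definition _ := GRing.Zmodule_isComNzRing.Build (quad E)
  quad_mulA quad_mulC quad_mul1 quad_mulD quad_one_neq0.
End QuadRing.

Lemma quad1 E : (1 : quad E) = (1, 0). Proof. by []. Qed.

Lemma quadM1 E (x y : quad E) : (x * y).1 = x.1 * y.1 - E * x.2 * y.2.
Proof. by []. Qed.

Lemma quadM2 E (x y : quad E) : (x * y).2 = x.1 * y.2 + x.2 * y.1.
Proof. by []. Qed.

Lemma quadN1 E (x : quad E) : (- x).1 = - x.1. Proof. by []. Qed.

Lemma quadN2 E (x : quad E) : (- x).2 = - x.2. Proof. by []. Qed.

Definition qnorm E (x : quad E) : int := x.1 ^+ 2 + E * x.2 ^+ 2.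

Lemma qnormM E (x y : quad E) : qnorm (x * y) = qnorm x * qnorm y.
Proof. by rewrite /qnorm quadM1 quadM2; ring. Qed.

Lemma qnormX E (x : quad E) n : qnorm (x ^+ n) = qnorm x ^+ n.
Proof.
elim: n => [|n IHn]; last by rewrite !exprS qnormM IHn.
by rewrite !expr0 /qnorm /=; ring.
Qed.

Lemma dvd_quadX2 E (x : quad E) n : (x.2 %| (x ^+ n).2)%Z.
Proof.
elim: n => [|n IHn]; first by rewrite expr0 dvdz0.
rewrite exprS quadM2; apply: rpredD; first exact: dvdz_mull.
exact: dvdz_mulr.
Qed.

(** By Bezout, x is a quotient of a power of x ^ m by a power of x ^ n, both of which are
    integers modulo q and invertible there since q does not divide the norm. *)
Lemma prime_dvd_quadX2_gcd E (x : quad E) (q m n : nat) : prime q ->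
  coprime m n -> ~ (q %| qnorm x)%Z ->
  (q %| (x ^+ m).2)%Z -> (q %| (x ^+ n).2)%Z -> (q %| x.2)%Z.
Proof.
move=> pq com Nq qm qn.
case: (posnP m) => [m0|m_gt0].
  by move: com qn; rewrite m0 /coprime gcd0n => /eqP->; rewrite expr1.
(* Bezout: u * m = v * n + 1. *)
case: (@egcdnP m n m_gt0) => u v e _; rewrite (eqP com) in e.
have qu : (q %| (x ^+ (u * m)).2)%Z.
  by rewrite mulnC exprM (dvdz_trans qm) ?dvd_quadX2.
have qv : (q %| (x ^+ (v * n)).2)%Z.
  by rewrite mulnC exprM (dvdz_trans qn) ?dvd_quadX2.
have : (q %| (x ^+ (v * n)).1 * x.2)%Z.
  move: qu; rewrite e exprD expr1 quadM2 rpredDr //.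
  by rewrite dvdz_mulr.
case/(prime_dvdzM pq) => // qa; case: Nq.
apply: (@prime_dvdzX q _ (v * n)) => //; rewrite -qnormX /qnorm.
by rewrite rpredD // !expr2 !dvdz_mull.
Qed.

(** When r ^ 2 = - E modulo C ^ n, the second condition says that x lies in the ideal
    (C ^ n, sqrt (- E) - r), of norm C ^ n.  Together with the norm it makes x a
    generator of that ideal; congruences thus replace ideals. *)
Definition aligned E (C r : int) (n : nat) (x : quad E) : Prop :=
  qnorm x = C ^+ n /\ (C ^+ n %| x.1 + x.2 * r)%Z.

(** The quotient is y times the conjugate of x, divided by the norm C ^ n of x. *)
Lemma aligned_div E (C r : int) (n m M : nat) (x y : quad E) : C != 0 ->
  (n <= m <= M)%N -> (C ^+ M %| r ^+ 2 + E)%Z ->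
  aligned C r n x -> aligned C r m y ->
  exists2 w : quad E, aligned C r (m - n) w & y = x * w.
Proof.
move=> C0 /andP[nm mM] rE [Nx ax] [Ny ay].
have Cn0 : C ^+ n != 0 by rewrite expf_neq0.
have dnm : (C ^+ n %| C ^+ m)%Z by rewrite dvdz_exp2l.
have dnE : (C ^+ n %| r ^+ 2 + E)%Z.
  by apply: dvdz_trans rE; rewrite dvdz_exp2l // (leq_trans nm).
have dmE : (C ^+ m %| r ^+ 2 + E)%Z by apply: dvdz_trans rE; rewrite dvdz_exp2l.
have /dvdzP[p Hp] : (C ^+ n %| x.1 * y.1 + E * x.2 * y.2)%Z.
  have -> : x.1 * y.1 + E * x.2 * y.2 = y.1 * (x.1 + x.2 * r)
     - x.2 * r * (y.1 + y.2 * r) + x.2 * y.2 * (r ^+ 2 + E) by ring.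
  rewrite rpredD ?rpredB //; apply: dvdz_mull => //.
  exact: dvdz_trans ay.
have /dvdzP[s Hs] : (C ^+ n %| x.1 * y.2 - x.2 * y.1)%Z.
  have -> : x.1 * y.2 - x.2 * y.1 = y.2 * (x.1 + x.2 * r)
     - x.2 * (y.1 + y.2 * r) by ring.
  rewrite rpredB //; apply: dvdz_mull => //.
  exact: dvdz_trans ay.
exists ((p, s) : quad E); first split.
- apply: (@mulfI _ (C ^+ n * C ^+ n)); first by rewrite mulf_neq0.
  have -> : C ^+ n * C ^+ n * C ^+ (m - n) = C ^+ n * C ^+ m.
    by rewrite -mulrA -exprD subnKC.
  have -> : C ^+ n * C ^+ n * qnorm ((p, s) : quad E) =
      (p * C ^+ n) ^+ 2 + E * (s * C ^+ n) ^+ 2 by rewrite /qnorm /=; ring.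
  by rewrite -Hp -Hs -Nx -Ny /qnorm; ring.
- rewrite /= -(@dvdz_mul2r (C ^+ n)) //.
  rewrite -exprD subnK // mulrDl mulrAC -Hp -Hs.
  have -> : x.1 * y.1 + E * x.2 * y.2 + (x.1 * y.2 - x.2 * y.1) * r =
    (x.1 - x.2 * r) * (y.1 + y.2 * r) + x.2 * y.2 * (r ^+ 2 + E) by ring.
  by rewrite rpredD // dvdz_mull.
- rewrite [LHS]surjective_pairing; congr pair; apply: (mulfI Cn0) => /=.
  + have -> : C ^+ n * (x.1 * p - E * x.2 * s) =
      x.1 * (p * C ^+ n) - E * x.2 * (s * C ^+ n) by ring.
    by rewrite -Hp -Hs -Nx /qnorm; ring.
  + have -> : C ^+ n * (x.1 * s + x.2 * p) =
      x.1 * (s * C ^+ n) + x.2 * (p * C ^+ n) by ring.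
    by rewrite -Hp -Hs -Nx /qnorm; ring.
Qed.

Lemma qnorm1 E (x : quad E) : 1 < E -> qnorm x = 1 -> x = 1 \/ x = -1.
Proof.
case: x => a b E1; rewrite /qnorm /= => H.
have b0 : b = 0 by nia.
have : (a - 1) * (a + 1) = 0 by rewrite b0 in H; nia.
move/eqP; rewrite mulf_eq0 => /orP[] /eqP Ha.
  by left; rewrite quad1 b0 (_ : a = 1) //; lia.
by right; rewrite b0 (_ : a = -1) //; lia.
Qed.

Definition eq_up_to_sign (R : pzRingType) (x y : R) := x = y \/ x = - y.

(** Euclid's algorithm on the pair (n, m), dividing the element of larger exponent by
    the other.  It stops when the exponents agree, and then the quotient has norm 1, so
    it is 1 or -1. *)
Lemma aligned_common_root E (C r : int) (M n m : nat) (x y : quad E) :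
    C != 0 -> 1 < E -> (0 < n <= M)%N -> (0 < m <= M)%N ->
    (C ^+ M %| r ^+ 2 + E)%Z ->
    aligned C r n x -> aligned C r m y ->
  exists (g t s : nat) (w : quad E),
    [/\ coprime t s, n = (g * t)%N, m = (g * s)%N,
        qnorm w = C ^+ g & eq_up_to_sign x (w ^+ t) /\ eq_up_to_sign y (w ^+ s)].
Proof.
move=> C0 E1 + + rE.
have [k] := ubnP (n + m); elim: k n m x y => // k IHk n m x y.
wlog nm : n m x y / (n <= m)%N => [IH|].
  move=> lk hn hm ax ay; have [nm|/ltnW mn] := leqP n m; first exact: IH.
  have := IH m n y x mn; rewrite addnC => /(_ lk hm hn ay ax).
  case=> g [t [s [w [co e1 e2 Nw [H1 H2]]]]].
  by exists g, s, t, w; split; rewrite // coprime_sym.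
move=> lk /andP[n0 nM] /andP[m0 mM] ax ay.
have [|w aw yE] := aligned_div C0 _ rE ax ay; first by rewrite nm.
move: nm; rewrite leq_eqVlt => /orP[/eqP enm | nm].
  exists n, 1%N, 1%N, x; rewrite !muln1; split=> //; first by case: ax.
  split; first by left; rewrite expr1.
  have Nw : qnorm w = 1 by case: aw => -> _; rewrite enm subnn expr0.
  rewrite expr1 yE; case: (qnorm1 E1 Nw) => ->; [left | right];
    by rewrite ?mulr1 ?mulrN1.
have [|||g [t [s [v [co e1 e2 Nv [H1 H2]]]]]] := IHk n (m - n)%N x w _ _ _ ax aw.
- by lia.
- by lia.
- by lia.
exists g, t, (t + s)%N, v; split=> //.
- by rewrite /coprime gcdnDl.
- by rewrite mulnDr -e1 -e2 subnKC // ltnW.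
split=> //; rewrite /eq_up_to_sign yE exprD.
by case: H1 H2 => -> [] ->; rewrite ?mulrN ?mulNr ?opprK; by [left | right].
Qed.

(** * Odd powers of a sum of two square roots *)

(** The pair (P, Q) of the odd power
    (sqrt X + sqrt (- Y)) ^ (2 j + 1) = P sqrt X + Q sqrt (- Y); the recursion multiplies
    by (sqrt X + sqrt (- Y)) ^ 2 = X - Y + 2 sqrt (- X Y). *)
Fixpoint oddPQ (X Y : int) (j : nat) : int * int :=
  if j is i.+1 then
    let: (P, Q) := oddPQ X Y i in
    ((X - Y) * P - 2 * Y * Q, (X - Y) * Q + 2 * X * P)
  else (1, 1).

(** Here (X - Y, b) is the square of sqrt X + sqrt (- Y), so that its odd powers are the
    squares of P sqrt X + Q sqrt (- Y). *)
Lemma oddPQ_quad (E X Y b : int) j : E * b ^+ 2 = 4 * X * Y ->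
  ((X - Y, b) : quad E) ^+ j.*2.+1 =
    (X * (oddPQ X Y j).1 ^+ 2 - Y * (oddPQ X Y j).2 ^+ 2,
     b * ((oddPQ X Y j).1 * (oddPQ X Y j).2)).
Proof.
move=> Eb; elim: j => [|j IHj].
  by rewrite expr1 /=; congr pair; ring.
rewrite doubleS 2!exprS {}IHj /=; case: (oddPQ X Y j) => P Q /=.
have Ebb : E * b * b = 4 * X * Y by rewrite -Eb; ring.
rewrite [LHS]surjective_pairing !quadM1 !quadM2 /=; congr pair.
  transitivity ((X - Y) * ((X - Y) * (X * P ^+ 2 - Y * Q ^+ 2)
      - E * b * b * P * Q) - E * b * b * ((X - Y) * P * Q
      + X * P ^+ 2 - Y * Q ^+ 2)); first ring.
  rewrite Ebb; ring.
transitivity (b * ((X - Y) ^+ 2 * P * Q * 1 + 2 * (X - Y) * (X * P ^+ 2 - Y * Q ^+ 2)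
   - E * b * b * P * Q)); first ring.
by rewrite Ebb; ring.
Qed.

Lemma oddPQ_norm (X Y : int) j :
  X * (oddPQ X Y j).1 ^+ 2 + Y * (oddPQ X Y j).2 ^+ 2 = (X + Y) ^+ j.*2.+1.
Proof.
elim: j => [|j IHj]; first by rewrite /=; ring.
rewrite (exprD _ 2 j.*2.+1) -{}IHj /=; case: (oddPQ X Y j) => P Q /=; ring.
Qed.

(** Exchanging X and Y multiplies sqrt X + sqrt (- Y) by a square root of -1, up to
    conjugation. *)
Lemma oddPQ_sym (X Y : int) j : oddPQ Y X j =
  ((-1) ^+ j * (oddPQ X Y j).2, (-1) ^+ j * (oddPQ X Y j).1).
Proof.
elim: j => [|j IHj] //=; rewrite {}IHj.
by case: (oddPQ X Y j) => P Q /=; rewrite exprS; congr pair; ring.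
Qed.

(** The binomial expansion of (sqrt X + sqrt (- Y)) ^ (2 j + 1) to first order in X. *)
Lemma oddPQ_modX (X Y : int) j : exists k l : int,
  (oddPQ X Y j).1 = j.*2.+1%:Z * (- Y) ^+ j + X * k
  /\ (oddPQ X Y j).2 = (- Y) ^+ j + X * l.
Proof.
elim: j => [|j [k [l]]]; first by exists 0, 0; rewrite !mulr0 !addr0 mulr1.
rewrite /=; case: (oddPQ X Y j) => P Q /= [-> ->].
rewrite exprS; set Z := (- Y) ^+ j.
exists ((X - Y) * k - 2 * Y * l + j.*2.+1%:Z * Z).
exists ((X - Y) * l + 2 * j.*2.+1%:Z * Z + 2 * X * k + Z).
have -> : j.+1.*2.+1%:Z = j.*2.+1%:Z + 2 by lia.
by split; ring.
Qed.

(** The same expansion to second order.  The coefficient of X in P is a binomial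
    coefficient (2 j + 1 choose 3), which has the factor 2 j + 1 after multiplication
    by 3. *)
Lemma oddPQ_modX2 (X Y : int) j : exists k l : int,
  3 * (oddPQ X Y j).1 * - Y =
    j.*2.+1%:Z * (- Y) ^+ j * (3 * - Y + j%:Z * (2 * j%:Z - 1) * X)
      + X ^+ 2 * k
  /\ (oddPQ X Y j).2 * - Y =
    (- Y) ^+ j * (- Y + j%:Z * j.*2.+1%:Z * X) + X ^+ 2 * l.
Proof.
elim: j => [|j [k [l]]]; first by exists 0, 0; rewrite double0 expr0 /=; split; ring.
have [k' [l' []]] := oddPQ_modX X Y j.
have -> : j.+1.*2.+1%:Z = 2 * j%:Z + 3 by lia.
have -> : j.*2.+1%:Z = 2 * j%:Z + 1 by lia.
have -> : j.+1%:Z = j%:Z + 1 by lia.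
rewrite /=; case: (oddPQ X Y j) => P Q /= EP _ [HP HQ].
rewrite exprS; set Z := (- Y) ^+ j in EP HP HQ *; set J := j%:Z in EP HP HQ *.
exists ((X - Y) * k - 6 * Y * l + (2 * J + 1) * Z * J * (2 * J - 1)).
exists ((X - Y) * l + Z * J * (2 * J + 1) - 2 * Y * k').
split.
  transitivity ((X - Y) * (3 * P * - Y) - 6 * Y * (Q * - Y)); first ring.
  by rewrite HP HQ; ring.
transitivity ((X - Y) * (Q * - Y) - 2 * X * Y * P); first ring.
by rewrite HQ EP; ring.
Qed.

Lemma oddPQ_odd (X Y w : int) j : X + Y = 2 * w + 1 ->
  exists k l : int,
    (oddPQ X Y j).1 = 2 * k + 1 /\ (oddPQ X Y j).2 = 2 * l + 1.
Proof.
move=> XY; elim: j => [|j [k [l]]]; first by exists 0, 0.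
rewrite /=; case: (oddPQ X Y j) => P Q /= [-> ->].
have -> : X = 2 * w + 1 - Y by lia.
exists ((w - Y) * (2 * k + 1) + k - Y * (2 * l + 1)).
exists ((w - Y) * (2 * l + 1) + l + (2 * w + 1 - Y) * (2 * k + 1)).
by split; ring.
Qed.

(** P is (2 j + 1) (- Y) ^ j modulo X, so a prime that divides P and X divides 2 j + 1.
    It cannot divide Y instead, since P ^ 2 X + Q ^ 2 Y is a power of X + Y. *)
Lemma oddPQ_prime_factor (X Y w : int) (j q : nat) : X + Y = 2 * w + 1 ->
  (forall r, prime r -> (r %| X)%Z -> ~ (r %| Y)%Z) ->
  prime q -> (q %| (oddPQ X Y j).1)%Z -> (q %| 4 * X * Y)%Z ->
  (q %| X)%Z /\ (q %| j.*2.+1)%N.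
Proof.
move=> Hw cop pq qP q4.
have q2 : ~ (q %| 2)%Z.
  move=> /dvdn_leq q2; have {}q2 : q = 2%N by have := prime_gt1 pq; lia.
  have [k [l [Pk _]]] := oddPQ_odd j Hw.
  by move: qP; rewrite Pk q2; lia.
have NY : (q %| X)%Z -> ~ (q %| Y)%Z by exact: cop.
have qX : (q %| X)%Z.
  have : (q %| X * Y)%Z.
    move: q4; rewrite -mulrA => /(prime_dvdzM pq)[]// q4.
    by case: q2; apply: (@prime_dvdzX q 2 2).
  case/(prime_dvdzM pq) => // qY; exfalso.
  have : (q %| (X + Y) ^+ j.*2.+1)%Z.
    rewrite -oddPQ_norm; apply: rpredD; last exact: dvdz_mulr.
    by rewrite expr2 !dvdz_mull.
  move/(prime_dvdzX pq) => qXY; apply: (cop q) => //.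
  by rewrite -(addrK Y X) rpredB.
split=> //; have [k [l [Pk _]]] := oddPQ_modX X Y j.
move: qP; rewrite Pk rpredDr; last exact: dvdz_mulr.
by case/(prime_dvdzM pq) => // /(prime_dvdzX pq); rewrite rpredN => /(NY qX).
Qed.

(** The only possible prime factor of P is p, and the expansion to second order in X
    shows that p ^ 2 does not divide P when p > 3. *)
Lemma oddPQ_leq (X Y w : int) (p : nat) : X + Y = 2 * w + 1 ->
  (forall r, prime r -> (r %| X)%Z -> ~ (r %| Y)%Z) ->
  prime p -> (4 < p)%N -> (forall q : nat, prime q ->
     (q %| (oddPQ X Y p./2).1)%Z -> (q %| 4 * X * Y)%Z) ->
  (`|(oddPQ X Y p./2).1| <= p)%N.
Proof.
move=> Hw cop pp p4 HP; set j := p./2 in HP *.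
have pj : j.*2.+1 = p.
  have [p2|op] := even_prime pp; first by rewrite p2 in p4.
  by rewrite -[RHS]odd_double_half op.
have Hq q : prime q -> (q %| (oddPQ X Y j).1)%Z -> (q %| X)%Z /\ q = p.
  move=> pq qP; have [qX] := oddPQ_prime_factor Hw cop pq qP (HP q pq qP).
  by rewrite pj dvdn_prime2 // => /eqP.
have [k [l [Pk _]]] := oddPQ_odd j Hw.
apply: leq_only_prime_factor; [by rewrite Pk; lia|by rewrite prime_gt0| |].
  by move=> q pq qP; have [] := Hq q pq.
apply/negP => p2P.
have p2P' : ((p ^ 2)%N %| (oddPQ X Y j).1)%Z by [].
have [pX _] : (p %| X)%Z /\ p = p.
  apply: Hq => //; apply: dvdz_trans p2P'; exact: dvdn_mulr.
have [u [_ [Hu _]]] := oddPQ_modX2 X Y j; case/dvdzP: p2P' => v Hv.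
case/dvdzP: pX => t Ht; rewrite pj in Hu.
have : (p %| (- Y) ^+ j * (3 * - Y))%Z.
  have p0 : p%:Z != 0 by rewrite eqz_nat; lia.
  rewrite -(dvdz_mul2l p0).
  apply/dvdzP; exists (3 * v * - Y - t ^+ 2 * u
     - (- Y) ^+ j * (j%:Z * (2 * j%:Z - 1) * t)).
  have E1 : 3 * (v * p%:Z ^+ 2) * - Y = p%:Z * (- Y) ^+ j * (3 * - Y) +
     p%:Z * (- Y) ^+ j * (j%:Z * (2 * j%:Z - 1) * (t * p)) + (t * p) ^+ 2 * u.
    have : 3 * (v * (p ^ 2)%N) * - Y = 3 * (oddPQ X Y j).1 * - Y by rewrite Hv.
    by rewrite Hu Ht -mulnn PoszM => e; rewrite expr2 e; ring.
  have : p%:Z * ((- Y) ^+ j * (3 * - Y)) = 3 * (v * p%:Z ^+ 2) * - Y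
    - p%:Z * (- Y) ^+ j * (j%:Z * (2 * j%:Z - 1) * (t * p)) - (t * p) ^+ 2 * u.
    by rewrite E1; ring.
  by move=> ->; ring.
case/(prime_dvdzM pp).
  by move/(prime_dvdzX pp); rewrite rpredN => /(cop p pp); apply; apply/dvdzP; exists t.
case/(prime_dvdzM pp); first by move/dvdn_leq; lia.
by rewrite rpredN => /(cop p pp); apply; apply/dvdzP; exists t.
Qed.

Lemma sq_lt_exp3 (p : nat) : (4 < p)%N -> (p ^ 2 < 3 ^ p.-1)%N.
Proof.
elim: p => // p IHp; rewrite ltnS leq_eqVlt => /orP[/eqP<- //|p4].
have := IHp p4; case: p p4 {IHp} => // p p4; rewrite /= (expnS 3) -!mulnn; nia.
Qed.

(** For an exponent p > 4 this contradicts the norm identity of P and Q, once both are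
    at most p. *)
Lemma sum_squares_lt (X Y m P Q : int) (p : nat) : 0 < X -> 0 < Y -> X + Y = m ->
  2 < m -> (4 < p)%N -> (`|P| <= p)%N -> (`|Q| <= p)%N ->
  X * P ^+ 2 + Y * Q ^+ 2 < m ^+ p.
Proof.
move=> X0 Y0 XY m2 p4 Pp Qp.
have HP : P ^+ 2 <= p%:Z ^+ 2 by nia.
have HQ : Q ^+ 2 <= p%:Z ^+ 2 by nia.
apply: (@le_lt_trans _ _ (m * p%:Z ^+ 2)); first by nia.
have p0 : (0 < p)%N by lia.
have -> : m ^+ p = m * m ^+ p.-1 by rewrite -exprS prednK.
rewrite ltr_pM2l; last by lia.
apply: (@lt_le_trans _ _ (3 ^+ p.-1)).
  by have := sq_lt_exp3 p4; rewrite -ltz_nat -!natz !natrX natz.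
by apply: lerXn2r; rewrite ?nnegrE; lia.
Qed.

(** The other sign, Y = 3 X - 1, would give a power of 3 that is 5 modulo 8. *)
Lemma exceptional_of_cube (X Y : int) e : 0 < X -> 0 < Y ->
  (3 %| X)%Z -> (`|(3 * X - Y)%R| = 1)%N -> (`|(X - 3 * Y)%R| = 3 ^ e)%N ->
  Y = 3 * X + 1 /\ 8 * X + 3 = 3 ^+ e.
Proof.
move=> X0 Y0 X3 H1 H2.
have e3 : (3 ^ e)%N = 3 ^+ e :> int by rewrite PoszX.
have Hmod : (3 ^ e %% 8 = 1 \/ 3 ^ e %% 8 = 3)%N.
  elim: (e) => [|k [] IH]; [by left | right | left]; by rewrite expnS -modnMmr IH.
by rewrite -e3; move: (3 ^ e)%N H2 Hmod {e3} => n; lia.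
Qed.

Lemma no_common_prime (E a b m X Y : int) : m = X + Y -> E * b ^+ 2 = 4 * X * Y ->
  (forall q, prime q -> (q %| m)%Z -> ~ (q %| E * b)%Z) ->
  forall q, prime q -> (q %| X)%Z -> ~ (q %| Y)%Z.
Proof.
move=> mE XYE Hc q pq qX qY; apply: (Hc q pq); first by rewrite mE rpredD.
have : (q %| E * b * b)%Z.
  by rewrite -mulrA -expr2 XYE -mulrA dvdz_mull // dvdz_mulr.
by case/(prime_dvdzM pq) => //; exact: dvdz_mull.
Qed.

Lemma half_sum_half_diff (E D a b m w : int) : 0 < D -> E = 4 * D -> b != 0 ->
  m = 2 * w + 1 -> 0 < m -> a ^+ 2 + E * b ^+ 2 = m ^+ 2 ->
  exists X Y : int, [/\ 0 < X, 0 < Y, m = X + Y, a = X - Y & E * b ^+ 2 = 4 * X * Y].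
Proof.
move=> D0 ED b0 mw m0 Nx.
have [u Ha] : exists u, a = 2 * u \/ a = 2 * u + 1.
  by exists (a %/ 2)%Z; lia.
case: Ha => Ha; first by exfalso; rewrite Ha ED mw in Nx; nia.
exists (w + u + 1), (w - u).
have XYE : E * b ^+ 2 = 4 * (w + u + 1) * (w - u).
  by apply: (addrI (a ^+ 2)); rewrite Nx Ha mw; ring.
have b2 : 0 < b ^+ 2 by nia.
have W : 0 < (w + u + 1) * (w - u) by nia.
by split; lia || nia.
Qed.

(** The odd prime exponents.  If p > 3, both P and Q are at most p in absolute value,
    which the norm forbids.  If p = 3, then P = X - 3 Y and Q = 3 X - Y are, up to sign,
    powers of 3, and one of them is 1 because X and Y are coprime. *)
Lemma prime_power_exceptional (E D a b m w : int) (p : nat) :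
    0 < D -> E = 4 * D -> b != 0 -> m = 2 * w + 1 -> 1 < m ->
    a ^+ 2 + E * b ^+ 2 = m ^+ 2 ->
    (forall q, prime q -> (q %| m)%Z -> ~ (q %| E * b)%Z) ->
    prime p -> (2 < p)%N ->
    (forall q : nat, prime q -> (q %| (((a, b) : quad E) ^+ p).2)%Z ->
      (q %| E * b)%Z) ->
  exists (x : int) (e : nat),
    [/\ p = 3%N, 0 < x /\ 8 * x + 3 = 3 ^+ e, m = 4 * x + 1,
      (`|a| = 2 * x + 1 :> int) &
      `|(((a, b) : quad E) ^+ 3).2| = 3 ^+ e * `|b|].
Proof.
move=> D0 ED b0 mw m1 Nx Hc pp p2 H.
have m0 : 0 < m by lia.
have [X [Y [X0 Y0 mE aE XYE]]] := half_sum_half_diff D0 ED b0 mw m0 Nx.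
have cop := no_common_prime a mE XYE Hc.
have HwX : X + Y = 2 * w + 1 by rewrite -mE.
have HwY : Y + X = 2 * w + 1 by rewrite addrC.
have copY r : prime r -> (r %| Y)%Z -> ~ (r %| X)%Z.
  by move=> pr rY rX; exact: (cop r pr).
have pj : p./2.*2.+1 = p.
  have [p2'|op] := even_prime pp; first by rewrite p2' in p2.
  by rewrite -[RHS]odd_double_half op.
have HX (q : nat) : prime q ->
    (q %| (oddPQ X Y p./2).1)%Z -> (q %| 4 * X * Y)%Z.
  move=> pq qP; rewrite -XYE expr2 mulrA dvdz_mulr // H // aE -pj oddPQ_quad //=.
  by rewrite dvdz_mull // dvdz_mulr.
have HY (q : nat) : prime q ->
    (q %| (oddPQ Y X p./2).1)%Z -> (q %| 4 * Y * X)%Z.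
  move=> pq; rewrite oddPQ_sym /= rpredMsign => qP.
  rewrite mulrAC -XYE expr2 mulrA dvdz_mulr // H // aE -pj oddPQ_quad //=.
  by rewrite dvdz_mull // dvdz_mull.
have [p4|] := ltnP 4 p.
  have PX := oddPQ_leq HwX cop pp p4 HX.
  have := oddPQ_leq HwY copY pp p4 HY; rewrite oddPQ_sym /= abszMsign => PY.
  have := @sum_squares_lt X Y m _ _ p X0 Y0 (esym mE) _ p4 PX PY.
  have := oddPQ_norm X Y p./2; rewrite pj -mE => ->.
  by rewrite ltxx => /(_ ltac:(lia)).
move=> p4; have p3 : p = 3%N by case: p pp p2 p4 {H HX HY pj} => [|[|[|[|[]]]]].
rewrite p3 [3./2]/= in HX HY *.
have PE : (oddPQ X Y 1).1 = X - 3 * Y by rewrite /=; ring.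
have QE : (oddPQ Y X 1).1 = Y - 3 * X by rewrite /=; ring.
have EX q : prime q -> (q %| X - 3 * Y)%Z -> (q %| X)%Z /\ q = 3%N.
  rewrite -PE => pq qP.
  have [qX] := oddPQ_prime_factor HwX cop pq qP (HX q pq qP).
  by rewrite dvdn_prime2 // => /eqP.
have EY q : prime q -> (q %| Y - 3 * X)%Z -> (q %| Y)%Z /\ q = 3%N.
  rewrite -QE => pq qP.
  have [qY] := oddPQ_prime_factor HwY copY pq qP (HY q pq qP).
  by rewrite dvdn_prime2 // => /eqP.
have abs1 (Z : int) : Z != 0 -> (forall q, prime q -> ~ (q %| Z)%Z) -> (`|Z| = 1)%N.
  move=> Z0 HZ; have [Z1|Z1|//] := ltngtP `|Z| 1%N; first by lia.
  by case: (HZ _ (pdiv_prime Z1)); exact: pdiv_dvd.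
have P0 : X - 3 * Y != 0 by apply/eqP; lia.
have Q0 : Y - 3 * X != 0 by apply/eqP; lia.
have P1 : ~ (3 %| X)%Z -> (`|(X - 3 * Y)%R| = 1)%N.
  by move=> NX; apply: abs1 => // q pq /(EX q pq)[qX q3]; rewrite q3 in qX.
have Q1 : ~ (3 %| Y)%Z -> (`|(Y - 3 * X)%R| = 1)%N.
  by move=> NX; apply: abs1 => // q pq /(EY q pq)[qX q3]; rewrite q3 in qX.
have b3 : `|(((a, b) : quad E) ^+ 3).2| = `|b| * (`|X - 3 * Y| * `|Y - 3 * X|).
  rewrite aE (@oddPQ_quad E X Y b 1) //= !normrM; congr (_ * (_ * _)).
    by congr `|_|; ring.
  by rewrite -normrN; congr `|_|; ring.
have [X3|/negP NX] := boolP (3 %| X)%Z.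
  have NY : ~ (3 %| Y)%Z by exact: (cop 3%N).
  have := Q1 NY => Q1'.
  have [||e Pe] := @pow_only_prime_factor 3 `|(X - 3 * Y)%R|; first by lia.
    by move=> q pq /(EX q pq)[].
  have [YE xe] : Y = 3 * X + 1 /\ 8 * X + 3 = 3 ^+ e.
    by apply: exceptional_of_cube => //; clear -Q1'; lia.
  exists X, e; rewrite b3 -xe YE; split=> //; [clear -YE mE; lia | clear -YE aE X0; lia |].
  have -> : X - 3 * (3 * X + 1) = - (8 * X + 3) by ring.
  have -> : 3 * X + 1 - 3 * X = 1 by ring.
  rewrite normrN normr1 mulr1 mulrC [X in X * _]gtr0_norm //.
  by rewrite addr_gt0 ?mulr_gt0.
have [Y3|/negP NY] := boolP (3 %| Y)%Z.
  have := P1 NX => P1'.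
  have [||e Pe] := @pow_only_prime_factor 3 `|(Y - 3 * X)%R|; first by lia.
    by move=> q pq /(EY q pq)[].
  have [YE xe] : X = 3 * Y + 1 /\ 8 * Y + 3 = 3 ^+ e.
    by apply: exceptional_of_cube => //; clear -P1'; lia.
  exists Y, e; rewrite b3 -xe YE; split=> //; [clear -YE mE; lia | clear -YE aE Y0; lia |].
  have -> : Y - 3 * (3 * Y + 1) = - (8 * Y + 3) by ring.
  have -> : 3 * Y + 1 - 3 * Y = 1 by ring.
  rewrite normrN normr1 mul1r mulrC [X in X * _]gtr0_norm //.
  by rewrite addr_gt0 ?mulr_gt0.
by have := P1 NX; have := Q1 NY; lia.
Qed.

(** * Powers that acquire no new prime in their imaginary part *)

(** The elements for which the exponent 3 creates no new prime: with u and 3 u + 1 the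
    half sum and half difference of m and the real part of x, the imaginary part of
    the cube of x is multiplied by 8 u + 3. *)
Definition cube_exceptional (E m : int) (x : quad E) : Prop :=
  exists (u : int) (e : nat),
    [/\ 0 < u /\ 8 * u + 3 = 3 ^+ e, m = 4 * u + 1, (`|x.1| = 2 * u + 1 :> int) &
      `|(x ^+ 3).2| = 3 ^+ e * `|x.2|].

(** The exponent 9 is impossible.  The first cube puts a factor 9 into v (3 v + 1), hence
    into v, whereas 8 v + 3 is divisible by 9 as a power of 3. *)
Lemma cube_exceptional_chain (m1 m3 E : int) (x : quad E) :
  qnorm x = m1 ^+ 2 -> qnorm (x ^+ 3) = m3 ^+ 2 ->
  cube_exceptional m1 x -> ~ cube_exceptional m3 (x ^+ 3).
Proof.
move=> N1 N3 [u [e [[u0 ue] mu xu bu]]] [v [f [[v0 vf] mv xv _]]].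
have e0 : (0 < e)%N by case: e ue {bu} => //; rewrite expr0; lia.
have f1 : (1 < f)%N by case: f vf => [|[]] //; rewrite ?expr0 ?expr1; lia.
have E1 : E * x.2 ^+ 2 = 4 * (u * (3 * u + 1)).
  have : x.1 ^+ 2 = (2 * u + 1) ^+ 2 by rewrite -xu sqr_normz.
  by move: N1; rewrite /qnorm mu => H1 H2; apply: (addrI (x.1 ^+ 2)); rewrite H1 H2; ring.
have E3 : E * (x ^+ 3).2 ^+ 2 = 4 * (v * (3 * v + 1)).
  have : (x ^+ 3).1 ^+ 2 = (2 * v + 1) ^+ 2 by rewrite -xv sqr_normz.
  move: N3; rewrite /qnorm mv => H1 H2.
  by apply: (addrI ((x ^+ 3).1 ^+ 2)); rewrite H1 H2; ring.
have E4 : v * (3 * v + 1) = 9 * (3 ^+ e.-1) ^+ 2 * (u * (3 * u + 1)).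
  apply: (@mulfI _ 4) => //; rewrite -E3 -sqr_normz bu.
  have -> : (3 : int) ^+ e = 3 * 3 ^+ e.-1 by rewrite -exprS prednK.
  by rewrite exprMn sqr_normz mulrCA E1; ring.
(* Only the factor 9 of the square of 3 ^ e matters from here on. *)
have {}E4 : exists k, v * (3 * v + 1) = 9 * k.
  by exists ((3 ^+ e.-1) ^+ 2 * (u * (3 * u + 1))); rewrite E4 -mulrA.
have {}vf : exists k, 8 * v + 3 = 9 * k.
  by exists (3 ^+ f.-2); rewrite vf -{1}(subnKC f1) exprD subn2.
case: E4 => k E4; case: vf => l vf.
have vs : v = 3 * (3 * k - v ^+ 2).
  have -> : 3 * (3 * k - v ^+ 2) = 9 * k - 3 * v ^+ 2 by ring.
  by rewrite -E4; ring.
move: (3 * k - v ^+ 2) vs => s vs; rewrite vs in E4 vf.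
have : s = 3 * (k - 3 * s ^+ 2).
  apply: (@mulfI _ 3) => //.
  have -> : 3 * (3 * (k - 3 * s ^+ 2)) = 9 * k - 27 * s ^+ 2 by ring.
  by rewrite -E4; ring.
by move: (k - _) vf => {E4 vs v0 mv xv} r; lia.
Qed.

Section PowerAnalysis.
Variables (E D m w : int) (x : quad E).
Hypotheses (D0 : 0 < D) (ED : E = 4 * D) (mw : m = 2 * w + 1) (m1 : 1 < m).
Hypothesis Nx : qnorm x = m ^+ 2.

(** The imaginary part of x ^ k has only prime divisors that E or the imaginary part of x
    have, and E and that part are prime to the norm.  This is what remains, for the exponents of two
    solutions of one class, of the fact that both have the same prime divisors. *)
Definition radical_stable k :=
  (forall q : nat, prime q -> (q %| (x ^+ k).2)%Z -> (q %| E * x.2)%Z) /\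
  (forall q : nat, prime q -> (q %| m)%Z -> ~ (q %| E * (x ^+ k).2)%Z).

Lemma radical_stable_dvd k l : (l %| k)%N -> radical_stable k -> radical_stable l.
Proof.
move=> /dvdnP[j kE] [H Hc].
have lk : ((x ^+ l).2 %| (x ^+ k).2)%Z by rewrite kE mulnC exprM dvd_quadX2.
split=> q pq; first by move=> ql; apply: H => //; apply: dvdz_trans lk.
by move=> qm ql; apply: (Hc q pq qm); apply: (dvdz_trans ql); rewrite dvdz_mul.
Qed.

Lemma dvd_quadX2_exp i k : (i %| k)%N -> ((x ^+ i).2 %| (x ^+ k).2)%Z.
Proof. by move=> /dvdnP[j ->]; rewrite mulnC exprM dvd_quadX2. Qed.

Lemma odd_base i : exists v, m ^+ i = 2 * v + 1.
Proof.
rewrite mw; elim: i => [|i [v IH]]; first by exists 0.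
by exists (2 * w * v + w + v); rewrite exprS IH; ring.
Qed.

Lemma radical_stable_odd_prime (k l p : nat) : k = (l * p)%N -> (0 < l)%N ->
  prime p -> (2 < p)%N -> radical_stable k ->
  p = 3%N /\ cube_exceptional (m ^+ l) (x ^+ l).
Proof.
move=> kE l0 pp p2 [H Hc].
have lk : ((x ^+ l).2 %| (x ^+ k).2)%Z by apply: dvd_quadX2_exp; rewrite kE dvdn_mulr.
have xl : x ^+ l = ((x ^+ l).1, (x ^+ l).2) by rewrite -surjective_pairing.
have bl0 : (x ^+ l).2 != 0.
  apply/eqP => bl; have m1' : (1 < `|m|)%N by lia.
  apply: (Hc _ (pdiv_prime m1')); first exact: pdiv_dvd.
  by move: lk; rewrite bl dvd0z => /eqP->; rewrite mulr0 dvdz0.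
have [v mv] := odd_base l.
have ml1 : 1 < m ^+ l by rewrite exprn_egt1 // -lt0n.
have Nl : (x ^+ l).1 ^+ 2 + E * (x ^+ l).2 ^+ 2 = (m ^+ l) ^+ 2.
  by have := qnormX x l; rewrite /qnorm => ->; rewrite -[_ + _]/(qnorm x) Nx exprAC.
have [||u [e [-> ue mu xu bu]]] :=
   @prime_power_exceptional E D _ _ _ v p D0 ED bl0 mv ml1 Nl _ pp p2.
- move=> q pq /(prime_dvdzX pq) qm ql; apply: (Hc q pq qm).
  by apply: (dvdz_trans ql); rewrite dvdz_mul.
- move=> q pq; rewrite -xl -exprM -kE => /(H q pq) qx; apply: (dvdz_trans qx).
  by rewrite dvdz_mul ?dvd_quadX2.
by split=> //; exists u, e; rewrite {2}xl.
Qed.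

(** Every prime factor of k is 3 by the case of a prime exponent, and 9 does not divide
    k. *)
Lemma radical_stable_odd k : odd k -> (1 < k)%N -> radical_stable k ->
  k = 3%N /\ cube_exceptional m x.
Proof.
have step n : odd n -> (1 < n)%N -> radical_stable n ->
    exists2 l, n = (l * 3)%N & cube_exceptional (m ^+ l) (x ^+ l).
  move=> on n1 sn; have /dvdnP[l nE] := pdiv_dvd n.
  have pp := pdiv_prime n1.
  have p2 : (2 < pdiv n)%N.
    rewrite ltn_neqAle prime_gt1 // andbT; apply: contraL on => /eqP e2.
    by rewrite nE -e2 oddM andbF.
  have l0 : (0 < l)%N by rewrite lt0n; apply: contraTneq n1 => l0; rewrite nE l0.
  have [p3 ex] := radical_stable_odd_prime nE l0 pp p2 sn.
  by exists l => //; rewrite -p3.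
move=> ok k1 sk; have [l kE exl] := step k ok k1 sk.
have [l1|l1|l1] := ltngtP l 1.
- by move: k1; rewrite kE; lia.
- have ol : odd l by move: ok; rewrite kE oddM => /andP[].
  have sl : radical_stable l by apply: radical_stable_dvd sk; rewrite kE dvdn_mulr.
  have [j lE exj] := step l ol l1 sl; exfalso.
  have N i : qnorm (x ^+ i) = (m ^+ i) ^+ 2 by rewrite qnormX Nx exprAC.
  move: exl; have := N l; rewrite lE exprM => N3.
  by apply: (cube_exceptional_chain (N j) N3 exj).
by move: exl; rewrite kE l1 !expr1.
Qed.

(** The imaginary part of x ^ (2 i) is twice the product of the real and imaginary parts
    of x ^ i.  The real part a of x ^ i is prime to E and to the imaginary part of x, so
    it can have no prime divisor: it is 1 or -1.  An even k is then excluded by the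
    duplication formula 2 a ^ 2 - m ^ (2 i) for the real part, and an odd k > 1 would
    make x exceptional for cubes, which requires a real part greater than 1. *)
Lemma radical_stable_even k : (0 < k)%N -> radical_stable k.*2 ->
  k = 1%N /\ (`|x.1| = 1)%N.
Proof.
move=> k0 [H Hc].
have unit_re i : (i.*2 %| k.*2)%N -> (`|(x ^+ i).1| = 1)%N.
  move=> ik; have b2i : (x ^+ i.*2).2 = 2 * ((x ^+ i).1 * (x ^+ i).2).
    by rewrite -muln2 exprM expr2 quadM2; ring.
  have Ni : qnorm (x ^+ i) = (m ^+ i) ^+ 2 by rewrite qnormX Nx exprAC.
  have lk := dvd_quadX2_exp ik.
  have H1 q : prime q -> ~ (q %| (x ^+ i).1)%Z.
    move=> pq qa.
    have qx : (q %| E * x.2)%Z.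
      apply: H => //; apply: dvdz_trans lk; rewrite b2i.
      by rewrite dvdz_mull // dvdz_mulr.
    have qi : (q %| E * (x ^+ i).2)%Z.
      by apply: (dvdz_trans qx); rewrite dvdz_mul ?dvd_quadX2.
    have qm : (q %| m)%Z.
      apply: (@prime_dvdzX q m i) => //; apply: (@prime_dvdzX q _ 2) => //.
      rewrite -Ni /qnorm; apply: rpredD; first by rewrite expr2 dvdz_mulr.
      by rewrite expr2 mulrA dvdz_mulr.
    apply: (Hc q pq qm); apply: (dvdz_trans qx).
    by rewrite dvdz_mul ?dvd_quadX2.
  have [Z1|Z1|//] := ltngtP `|(x ^+ i).1| 1%N.
    have Z0 : (x ^+ i).1 = 0 by lia.
    by case: (H1 2%N) => //; rewrite Z0 dvdz0.
  by case: (H1 _ (pdiv_prime Z1)); exact: pdiv_dvd.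
have a1 : (`|x.1| = 1)%N by have := unit_re 1%N; rewrite expr1; apply; rewrite -(muln2 k) dvdn_mull.
split=> //; have [ok|ek] := boolP (odd k).
  case: (ltngtP k 1%N) => // k1; first by move: k0 k1; case: (k).
  have [|_ [u [e [[u0 _] _ xu _]]]] := radical_stable_odd ok k1.
    by apply: radical_stable_dvd (conj H Hc); rewrite -mul2n dvdn_mull.
  by move: xu u0 a1; lia.
have [i kE] : exists i, k = i.*2 by exists k./2; rewrite even_halfK.
have ai : (`|(x ^+ i).1| = 1)%N by rewrite unit_re // kE -(muln2 i.*2) dvdn_mulr.
have ak : (`|(x ^+ k).1| = 1)%N by rewrite unit_re.
have i0 : (0 < i)%N by move: k0; rewrite kE; case: (i).
have Ni : qnorm (x ^+ i) = (m ^+ i) ^+ 2 by rewrite qnormX Nx exprAC.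
have mi : 2 < m ^+ i.
  have : 1 < m ^+ i by rewrite exprn_egt1 // -lt0n.
  by have [v ->] := odd_base i; lia.
have a2 : (x ^+ i).1 ^+ 2 = 1.
  by rewrite -[LHS]sqr_normz; have -> : `|(x ^+ i).1| = 1 by lia.
have : (x ^+ k).1 = 2 * (x ^+ i).1 ^+ 2 - qnorm (x ^+ i).
  by rewrite kE -muln2 exprM expr2 quadM1 /qnorm; ring.
by rewrite a2 Ni; nia.
Qed.

(** Each exponent is 1, 2 or 3, and the conditions attached to 2 and to 3 exclude each
    other. *)
Lemma radical_stable_pair s t : coprime s t -> (0 < s <= t)%N -> (1 < t)%N ->
  radical_stable s -> radical_stable t ->
  s = 1%N /\ (t = 2%N /\ (`|x.1| = 1)%N \/ t = 3%N /\ cube_exceptional m x).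
Proof.
move=> co /andP[s0 st] t1 Hs Ht.
have cases n : (0 < n)%N -> radical_stable n ->
    [\/ n = 1%N, n = 2%N /\ (`|x.1| = 1)%N | n = 3%N /\ cube_exceptional m x].
  move=> n0 Hn; have [on|en] := boolP (odd n).
    case: (ltngtP n 1%N) => [|n1|]; first by case: (n) n0.
      by case: (radical_stable_odd on n1 Hn) => ? ?; constructor 3.
    by constructor 1.
  have nE : n = n./2.*2 by rewrite even_halfK.
  have [||h1 xh] := @radical_stable_even n./2.
  - by move: n0; rewrite {1}nE; case: (n./2).
  - by rewrite -nE.
  by constructor 2; rewrite nE h1.
have nex : (`|x.1| = 1)%N -> ~ cube_exceptional m x.
  by move=> x1 [u [e [[u0 _] _ xu _]]]; lia.
case: (cases t (ltnW t1) Ht) => [t1'|[tE ux]|[tE ex]]; first by rewrite t1' in t1.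
  case: (cases s s0 Hs) => [->|[sE _]|[sE _]]; first by split; [|left].
    by move: co; rewrite sE tE.
  by move: st; rewrite sE tE.
case: (cases s s0 Hs) => [->|[sE ux]|[sE _]]; first by split; [|right].
  by case: (nex ux ex).
by move: co; rewrite sE tE.
Qed.

End PowerAnalysis.
(** * Two solutions of the same class *)

(** Modulo c one has - X Y = X ^ 2 and - X' Y' = X' ^ 2.  With X Y = D e ^ 2 and
    X' Y' = D f ^ 2 the number s is D e f, and the condition says that X / e and X' / f
    are, up to sign, the same square root of - D modulo c. *)
Definition same_class (c X Y X' Y' : nat) : Prop :=
  exists2 s, (s ^ 2 = X * Y * (X' * Y'))%N &
    (c %| s + X * X')%N \/ (c%:Z %| s%:Z - (X * X')%N%:Z)%Z.

(** The pair (1, 4 X Y) of sum (X + Y) ^ 2; it is recorded through its product W, which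
    determines it together with z'. *)
Definition doubled (X Y z W z' : nat) : Prop :=
  [/\ z' = (2 * z)%N, W = (4 * (X * Y))%N & X = Y.+1 \/ Y = X.+1].

(** The pair obtained by cubing sqrt X + sqrt (- Y) when {X, Y} = {u, 3 u + 1}, again
    recorded through its product W. *)
Definition tripled (X Y z W z' : nat) : Prop :=
  exists u k : nat, [/\ z' = (3 * z)%N, (0 < u)%N, (8 * u + 3 = 3 ^ k)%N,
    W = ((3 ^ k) ^ 2 * (X * Y))%N & X = u /\ Y = (3 * u).+1 \/ Y = u /\ X = (3 * u).+1].

Lemma same_class_sym c X Y X' Y' : same_class c X Y X' Y' -> same_class c X' Y' X Y.
Proof. by case=> s sE H; exists s; rewrite ?sE 1?mulnC // ?[(X' * X)%N]mulnC. Qed.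

Section Descent.
Variables (c X Y X' Y' z z' : nat).
Hypotheses (c1 : (1 < c)%N) (oc : odd c).
Hypotheses (X0 : (0 < X)%N) (Y0 : (0 < Y)%N) (X0' : (0 < X')%N) (Y0' : (0 < Y')%N).
Hypotheses (XY : (X + Y = c ^ z)%N) (XY' : (X' + Y' = c ^ z')%N).
Hypotheses (z0 : (0 < z)%N) (zz : (z <= z')%N).
Hypotheses (cXY : coprime c (X * Y)) (cXY' : coprime c (X' * Y')).

(** Both elements are made aligned with one square root r of - 4 D modulo c ^ (2 z').  It
    is read off the second solution; that the first one is aligned with it needs only
    to be checked modulo c, where it is the condition of being in the same class, as the
    difference and the sum of the two candidates have a product divisible by c ^ (2 z)
    while c is prime to the sum. *)
Lemma same_class_common_root : same_class c X Y X' Y' ->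
  exists (D : nat) (e f : nat) (g t s : nat) (w : quad (4 * D%:Z)),
   [/\ (0 < D)%N, (X * Y = D * e ^ 2)%N /\ (X' * Y' = D * f ^ 2)%N,
       coprime t s /\ qnorm w = (c%:Z ^+ g) ^+ 2, z = (g * t)%N /\ z' = (g * s)%N &
       [/\ `|(w ^+ t).1| = `|X%:Z - Y%:Z|, `|(w ^+ t).2| = e%:Z,
           `|(w ^+ s).1| = `|X'%:Z - Y'%:Z| & `|(w ^+ s).2| = f%:Z]].
Proof.
case=> s0 s0E Hs.
have XY0 : (0 < X * Y)%N by rewrite muln_gt0 X0.
have XY0' : (0 < X' * Y')%N by rewrite muln_gt0 X0'.
have [D [e [f [mE nE sE]]]] := square_mul_common XY0 s0E.
have D0 : (0 < D)%N by rewrite lt0n; apply: contraTneq XY0 => d; rewrite mE d.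
have [sg sgE Hsg] : exists2 sg : int, `|sg| = 1 &
    (c%:Z %| sg * s0%:Z + X%:Z * X'%:Z)%Z.
  case: Hs => Hs; first by exists 1; rewrite // mul1r.
  exists (-1) => //; rewrite -rpredN.
  by have -> : - (-1 * s0%:Z + X%:Z * X'%:Z) = s0%:Z - (X * X')%N%:Z
    by rewrite PoszM; ring.
have eXY : X%:Z * Y%:Z = D%:Z * e%:Z ^+ 2.
  by rewrite -PoszM mE -mulnn !PoszM expr2.
have eXY' : X'%:Z * Y'%:Z = D%:Z * f%:Z ^+ 2.
  by rewrite -PoszM nE -mulnn !PoszM expr2.
set E := 4 * D%:Z; set C : int := c%:Z ^+ 2.
pose x : quad E := (X%:Z - Y%:Z, e%:Z); pose y : quad E := (X'%:Z - Y'%:Z, sg * f%:Z).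
have XYz : X%:Z + Y%:Z = c%:Z ^+ z by rewrite -PoszD XY PoszX.
have XYz' : X'%:Z + Y'%:Z = c%:Z ^+ z' by rewrite -PoszD XY' PoszX.
have Ee : E * e%:Z ^+ 2 = 4 * X%:Z * Y%:Z.
  by rewrite /E -mulrA -[RHS]mulrA eXY.
have Ef : E * (sg * f%:Z) ^+ 2 = 4 * X'%:Z * Y'%:Z.
  rewrite exprMn -[sg ^+ 2]sqr_normz sgE expr1n mul1r.
  by rewrite /E -mulrA -[RHS]mulrA eXY'.
have Nx : qnorm x = C ^+ z.
  rewrite /qnorm /= Ee /C -exprM mulnC exprM -XYz; ring.
have Ny : qnorm y = C ^+ z'.
  rewrite /qnorm /= Ef /C -exprM mulnC exprM -XYz'; ring.
have c2 : coprimez c%:Z 2 by rewrite coprimezE coprimen2.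
have cX : coprimez c%:Z X%:Z by move: cXY; rewrite coprimeMr => /andP[].
have cY : coprimez c%:Z Y%:Z by move: cXY; rewrite coprimeMr => /andP[].
have cD : coprimez c%:Z D%:Z.
  by move: cXY; rewrite mE coprimeMr => /andP[].
have ce : coprimez c%:Z e%:Z.
  by move: cXY; rewrite mE -mulnn !coprimeMr => /and3P[].
have cf : coprimez c%:Z (sg * f%:Z).
  have : coprime c f by move: cXY'; rewrite nE -mulnn !coprimeMr => /and3P[].
  by rewrite coprimezE abszM; move: sgE => /(congr1 absz); rewrite /= => ->; rewrite mul1n.
have cC n (u : int) : coprimez c%:Z u -> coprimez (C ^+ n) u.
  by move=> cu; rewrite /C -exprM coprimezXl.
have [[r1 r2] /= r12] := coprimezP _ _ (cC z' _ cf).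
(* The root r of - E modulo C ^ z' for which y.1 + y.2 * r = 0. *)
pose r := - r2 * (X'%:Z - Y'%:Z).
have br : (sg * f%:Z) * r = - (X'%:Z - Y'%:Z) + r1 * (X'%:Z - Y'%:Z) * C ^+ z'.
  transitivity (- (X'%:Z - Y'%:Z) * (r1 * C ^+ z' + r2 * (sg * f%:Z))
     + r1 * (X'%:Z - Y'%:Z) * C ^+ z'); first by rewrite /r; ring.
  by rewrite r12; ring.
have rE : (C ^+ z' %| r ^+ 2 + E)%Z.
  rewrite -(@Gauss_dvdzr _ ((sg * f%:Z) ^+ 2)); last by rewrite coprimezXr ?cC.
  apply/dvdzP; exists (1 + (r1 * (X'%:Z - Y'%:Z)) * (r1 * (X'%:Z - Y'%:Z) * C ^+ z'
       - 2 * (X'%:Z - Y'%:Z))).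
  transitivity ((sg * f%:Z * r) ^+ 2 + E * (sg * f%:Z) ^+ 2); first ring.
  rewrite br; have -> : E * (sg * f%:Z) ^+ 2 = C ^+ z' - (X'%:Z - Y'%:Z) ^+ 2.
    by rewrite -Ny /qnorm /=; ring.
  ring.
have ay : aligned C r z' y.
  split=> //; rewrite /= br; apply/dvdzP; exists (r1 * (X'%:Z - Y'%:Z)); ring.
have dCz : (C ^+ z %| C ^+ z')%Z by rewrite dvdz_exp2l.
have ax : aligned C r z x.
  split=> //=; rewrite -(@Gauss_dvdzr _ (sg * f%:Z)) ?cC //.
  have -> : sg * f%:Z * (X%:Z - Y%:Z + e%:Z * r) =
     (X%:Z - Y%:Z) * (sg * f%:Z) - e%:Z * (X'%:Z - Y'%:Z)
      + e%:Z * r1 * (X'%:Z - Y'%:Z) * C ^+ z'.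
    transitivity ((X%:Z - Y%:Z) * (sg * f%:Z) + e%:Z * (sg * f%:Z * r)); first ring.
    by rewrite br; ring.
  apply: rpredD; last by rewrite dvdz_mull.
  set A := _ - _.
  have cA : (c%:Z %| A)%Z.
    rewrite -(@Gauss_dvdzr _ (D%:Z * e%:Z)); last by rewrite coprimezMr cD.
    have -> : D%:Z * e%:Z * A = 2 * X%:Z * (sg * s0%:Z + X%:Z * X'%:Z)
       - (X%:Z + Y%:Z) * sg * s0%:Z - 2 * X%:Z * X'%:Z * (X%:Z + Y%:Z)
        + X%:Z * Y%:Z * (X'%:Z + Y'%:Z).
      rewrite eXY sE !PoszM.
      transitivity (D%:Z * e%:Z * (sg * f%:Z) * (X%:Z - Y%:Z) -
        D%:Z * e%:Z ^+ 2 * (X'%:Z - Y'%:Z)); first by rewrite /A; ring.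
      apply/eqP; rewrite -subr_eq0; apply/eqP; clear -eXY.
      transitivity (2 * X'%:Z * (X%:Z * Y%:Z - D%:Z * e%:Z ^+ 2)); first ring.
      by rewrite eXY; ring.
    have dXY : (c%:Z %| X%:Z + Y%:Z)%Z by rewrite XYz -(prednK z0) exprS dvdz_mulr.
    have dXY' : (c%:Z %| X'%:Z + Y'%:Z)%Z.
      by rewrite XYz' -(prednK (leq_trans z0 zz)) exprS dvdz_mulr.
    apply: rpredD; last by rewrite dvdz_mull.
    apply: rpredB; last by rewrite dvdz_mull.
    apply: rpredB; first by rewrite dvdz_mull.
    by rewrite -mulrA dvdz_mulr.
  have cB : coprimez c%:Z ((X%:Z - Y%:Z) * (sg * f%:Z) + e%:Z * (X'%:Z - Y'%:Z)).
    case/dvdzP: cA => k kE.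
    have -> : (X%:Z - Y%:Z) * (sg * f%:Z) + e%:Z * (X'%:Z - Y'%:Z) =
       - k * c%:Z + 2 * ((X%:Z - Y%:Z) * (sg * f%:Z)).
      by rewrite mulNr -kE /A; ring.
    rewrite /coprimez gcdzMDl -[_ == 1]/(coprimez _ _) 2!coprimezMr c2 cf andbT /=.
    have -> : X%:Z - Y%:Z = c%:Z ^+ z.-1 * c%:Z + - 2 * Y%:Z.
      by rewrite -exprSr prednK // -XYz; ring.
    by rewrite /coprimez gcdzMDl -[_ == 1]/(coprimez _ _) coprimezMr cY andbT.
  rewrite -(@Gauss_dvdzl _ _ ((X%:Z - Y%:Z) * (sg * f%:Z) + e%:Z * (X'%:Z - Y'%:Z)));
    last exact: cC.
  have -> : A * ((X%:Z - Y%:Z) * (sg * f%:Z) + e%:Z * (X'%:Z - Y'%:Z)) =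
     (qnorm x) * (sg * f%:Z) ^+ 2 - qnorm y * e%:Z ^+ 2.
    by rewrite /A /qnorm /=; ring.
  rewrite Nx Ny; apply: rpredB; first exact: dvdz_mulr.
  by rewrite dvdz_mulr.
have C0 : C != 0 by rewrite /C expf_neq0 // eqz_nat -lt0n ltnW.
have E1 : 1 < E by rewrite /E; clear -D0; lia.
have zM : (0 < z <= z')%N by rewrite z0.
have zM' : (0 < z' <= z')%N by rewrite leqnn (leq_trans z0).
have [g [t [s [w [co zE zE' Nw [xw yw]]]]]] := aligned_common_root C0 E1 zM zM' rE ax ay.
exists D, e, f, g, t, s, w; split=> //.
  by split=> //; rewrite Nw /C -!exprM mulnC.
have H (u v : quad E) : eq_up_to_sign u v -> `|v.1| = `|u.1| /\ `|v.2| = `|u.2|.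
  by case=> ->; rewrite ?quadN1 ?quadN2 ?normrN.
have [x1 x2] := H _ _ xw; have [y1 y2] := H _ _ yw.
by split; rewrite ?x1 ?x2 ?y1 ?y2 //= normrM sgE mul1r.
Qed.

(** The prime divisors of X Y and X' Y' being the same, a prime that divides the
    imaginary part of w ^ t but not 4 D also divides that of w ^ s, hence that of w as
    t and s are coprime.  So both exponents are stable, and they are 1 and 2, or 1 and
    3. *)
Lemma same_class_powers : same_class c X Y X' Y' ->
  (forall q, prime q -> (q %| X * Y)%N = (q %| X' * Y')%N) ->
  (X * Y, z)%N <> (X' * Y', z')%N ->
  doubled X Y z (X' * Y') z' \/ tripled X Y z (X' * Y') z'.
Proof.
move=> sc rad neq.
have [D [e [f [g [t [s [w [D0 [eXY eXY'] [co Nw] [zE zE'] [w1 w2 v1 v2]]]]]]]]] :=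
  same_class_common_root sc.
set E := 4 * D%:Z in w co Nw w1 w2 v1 v2 *.
have g0 : (0 < g)%N by move: z0; rewrite zE muln_gt0 => /andP[].
have t0 : (0 < t)%N by move: z0; rewrite zE muln_gt0 => /andP[].
have ts : (t <= s)%N by move: zz; rewrite zE zE' leq_pmul2l.
have prime_c q : prime q -> (q %| c)%N -> ~ (q %| X * Y)%N /\ q <> 2%N.
  move=> pq qc; split=> [qXY|q2]; last by move: oc; rewrite q2 dvdn2 oc in qc.
  have : (q %| gcdn c (X * Y))%N by rewrite dvdn_gcd qc.
  by rewrite (eqP cXY) dvdn1 => /eqP q1; rewrite q1 in pq.
have prime_m q n : prime q -> (q %| c%:Z ^+ n)%Z -> (q %| c)%N.
  by move=> pq /(prime_dvdzX pq).
have dvd_sq q k n : prime q -> (k = D * n ^ 2)%N ->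
    (q %| k)%N = (q %| D)%N || (q %| n)%N.
  by move=> pq ->; rewrite Euclid_dvdM // Euclid_dvdX // andbT.
have dvdE q (b : int) : prime q ->
    (q %| E * b)%Z <-> [\/ q = 2%N, (q %| D)%N | (q %| b)%Z].
  move=> pq; split.
    case/(prime_dvdzM pq); last by constructor 3.
    case/(prime_dvdzM pq); last by constructor 2.
    move=> q4; constructor 1; have : (q %| 2 ^ 2)%N by [].
    by rewrite Euclid_dvdX // dvdn_prime2 // => /andP[/eqP].
  case=> [->|qD|qb]; last by rewrite dvdz_mull.
    by rewrite dvdz_mulr // dvdz_mulr.
  by rewrite dvdz_mulr // dvdz_mull.
have stable (k l n o : nat) : coprime k l ->
    `|(w ^+ k).2| = n%:Z -> `|(w ^+ l).2| = o%:Z ->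
    (forall q, prime q -> (q %| X * Y)%N = (q %| D)%N || (q %| n)%N) ->
    (forall q, prime q -> (q %| X * Y)%N = (q %| D)%N || (q %| o)%N) ->
    radical_stable (c%:Z ^+ g) w k.
  move=> kl kn lo Hn Ho; split=> q pq.
    rewrite (dvdz_norm_nat _ kn) => qn; apply/dvdE => //.
    have := Ho q pq; rewrite Hn // qn orbT; have [qD _|_ /esym/= qo] := boolP (q %| D)%N.
      by constructor 2.
    constructor 3; apply: (prime_dvd_quadX2_gcd pq kl).
    - rewrite Nw => /(prime_dvdzX pq) /(prime_m _ _ pq) qc.
      by have [] := prime_c q pq qc; rewrite Hn // qn orbT.
    - by rewrite (dvdz_norm_nat _ kn).
    - by rewrite (dvdz_norm_nat _ lo).
  move=> /(prime_m _ _ pq) qc; have [NXY N2] := prime_c q pq qc.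
  move/(dvdE _ _ pq) => [//|qD|]; first by apply: NXY; rewrite Hn ?qD.
  by rewrite (dvdz_norm_nat _ kn) => qn; apply: NXY; rewrite Hn ?qn ?orbT.
have He q : prime q -> (q %| X * Y)%N = (q %| D)%N || (q %| e)%N.
  by move=> pq; apply: dvd_sq.
have Hf q : prime q -> (q %| X * Y)%N = (q %| D)%N || (q %| f)%N.
  by move=> pq; rewrite rad //; apply: dvd_sq.
have St : radical_stable (c%:Z ^+ g) w t by apply: (stable t s e f).
have Ss : radical_stable (c%:Z ^+ g) w s.
  by apply: (stable s t f e); rewrite // coprime_sym.
have abs_inj (a b : nat) : a%:Z = b%:Z -> a = b by case.
have s1 : (1 < s)%N.
  rewrite ltnNge; apply/negP => s1; have sE : s = 1%N by lia.
  have tE : t = 1%N by lia.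
  apply: neq; rewrite eXY eXY' zE zE' sE tE; congr (_ * _ ^ _, _)%N.
  by apply: abs_inj; rewrite -w2 -v2 sE tE.
have m1 : 1 < c%:Z ^+ g by rewrite exprn_egt1 // -?lt0n //; clear -c1; lia.
have [w0 mw] : exists w0, c%:Z = 2 * w0 + 1.
  by exists (c./2%:Z); rewrite -{1}(odd_double_half c) oc; clear; lia.
have [v0 mv] := odd_base mw g.
have D0' : 0 < D%:Z by [].
have ts' : (0 < t <= s)%N by rewrite t0.
have [t1 cases] := radical_stable_pair D0' (erefl E) mv m1 Nw co ts' s1 St Ss.
rewrite t1 muln1 in zE; rewrite t1 expr1 in w1 w2.
case: cases => [[sE wu]|[sE [u [k [[u0 uk] mu wu bu]]]]]; [left | right].
  split; first by rewrite zE' sE zE mulnC.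
    have fe : f = (2 * e)%N.
      apply: abs_inj; rewrite -v2 sE expr2 quadM2 PoszM -w2.
      have -> : w.1 * w.2 + w.2 * w.1 = 2 * w.1 * w.2 by ring.
      rewrite !normrM; have -> : `|w.1| = 1 by clear -wu; lia.
      by rewrite mulr1.
    by rewrite eXY eXY' fe; ring.
  by clear -wu w1; lia.
exists `|u|%N, k.
have fe : f = (3 ^ k * e)%N.
  apply: abs_inj; rewrite -v2 sE bu PoszM -w2; congr (_ * _).
  by rewrite PoszX.
have uk' : (8 * `|u|%N + 3 = 3 ^ k)%N.
  apply: abs_inj; rewrite PoszX -uk; clear -u0; lia.
split=> //; first by rewrite zE' sE zE mulnC.
- by clear -u0; lia.
- by rewrite eXY eXY' fe; ring.
have XYz : X%:Z + Y%:Z = 4 * u + 1.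
  by rewrite -mu -PoszD XY zE PoszX.
by clear -w1 wu XYz u0; lia.
Qed.
End Descent.
(** * Classes of exponents modulo two *)

(** The exponents are displayed and X, Y are not ordered, so that the summands and the
    bases can be exchanged freely. *)
Definition sol_exps (d e c X Y z x1 x2 y1 y2 : nat) : Prop :=
  [/\ (X + Y = c ^ z)%N, (X = d ^ x1 * e ^ x2)%N, (Y = d ^ y1 * e ^ y2)%N,
      (0 < x1 + y1)%N /\ (x1 * y1 = 0)%N & (0 < x2 + y2)%N /\ (x2 * y2 = 0)%N].

(** The three 2 x 2 minors are the coefficients of a relation, unless the vectors are
    pairwise proportional. *)
Lemma int_relation (u1 v1 u2 v2 u3 v3 : int) : exists n1 n2 n3 : int,
  [/\ n1 * u1 + n2 * u2 + n3 * u3 = 0, n1 * v1 + n2 * v2 + n3 * v3 = 0 &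
      [|| n1 != 0, n2 != 0 | n3 != 0]].
Proof.
pose n1 := u2 * v3 - u3 * v2; pose n2 := u3 * v1 - u1 * v3.
pose n3 := u1 * v2 - u2 * v1.
have [n0|] := boolP [|| n1 != 0, n2 != 0 | n3 != 0].
  by exists n1, n2, n3; split=> //; rewrite /n1 /n2 /n3; ring.
rewrite !negb_or !negbK => /and3P[_ _ /eqP n30].
have [u10|u1N] := eqVneq u1 0; last first.
  exists u2, (- u1), 0; rewrite oppr_eq0 u1N orbT; split=> //; first by ring.
  by transitivity (- n3); [rewrite /n3; ring | rewrite n30 oppr0].
have [v10|v1N] := eqVneq v1 0; last first.
  exists v2, (- v1), 0; rewrite oppr_eq0 v1N orbT; split=> //; last by ring.
  by transitivity n3; [rewrite /n3; ring | rewrite n30].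
by exists 1, 0, 0; rewrite u10 v10; split=> //; ring.
Qed.

(** A relation between the vectors, divided by 2 until a coefficient is odd and then
    reduced modulo 2.  This replaces the count of L / 2L. *)
Lemma parity_relation (u1 v1 u2 v2 u3 v3 : int) :
  exists (b1 b2 b3 : bool) (k1 k2 k3 : int), [/\ [|| b1, b2 | b3],
    b1%:Z * u1 + b2%:Z * u2 + b3%:Z * u3 = 2 * (k1 * u1 + k2 * u2 + k3 * u3) &
    b1%:Z * v1 + b2%:Z * v2 + b3%:Z * v3 = 2 * (k1 * v1 + k2 * v2 + k3 * v3)].
Proof.
have [n1 [n2 [n3 [Hu Hv n0]]]] := int_relation u1 v1 u2 v2 u3 v3.
have [N] := ubnP (`|n1| + `|n2| + `|n3|)%N.
elim: N n1 n2 n3 Hu Hv n0 => // N IHN n1 n2 n3 Hu Hv n0 lN.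
have half (n : int) : exists (b : bool) k, n = 2 * k + b%:Z.
  exists ((n %% 2)%Z != 0), (n %/ 2)%Z.
  by case: eqP => /=; lia.
have [b1 [k1 e1]] := half n1; have [b2 [k2 e2]] := half n2.
have [b3 [k3 e3]] := half n3.
have [bb|] := boolP [|| b1, b2 | b3].
  exists b1, b2, b3, (- k1), (- k2), (- k3); split=> //.
    apply/eqP; rewrite -subr_eq0 -Hu e1 e2 e3; apply/eqP; ring.
  apply/eqP; rewrite -subr_eq0 -Hv e1 e2 e3; apply/eqP; ring.
rewrite !negb_or => /and3P[/negbTE h1 /negbTE h2 /negbTE h3].
rewrite h1 h2 h3 !addr0 in e1 e2 e3.
apply: (IHN k1 k2 k3).
- by apply: (@mulfI _ 2) => //; rewrite mulr0 -Hu e1 e2 e3; ring.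
- by apply: (@mulfI _ 2) => //; rewrite mulr0 -Hv e1 e2 e3; ring.
- by move: n0; rewrite e1 e2 e3; clear; lia.
- by move: lN n0; rewrite e1 e2 e3; clear; lia.
Qed.

Section SignedPowers.
Variables (R : comUnitRingType) (d e : R).
Hypotheses (Ud : d \is a GRing.unit) (Ue : e \is a GRing.unit).
Hypothesis N1 : (-1 : R) != 1.

Definition monom (u v : int) : R := d ^ u * e ^ v.

Lemma monomD u v u' v' : monom (u + u') (v + v') = monom u v * monom u' v'.
Proof. by rewrite /monom !exprzDr // mulrACA. Qed.

Lemma monomM (n u v : int) : monom (n * u) (n * v) = monom u v ^ n.
Proof.
by rewrite /monom ![n * _]mulrC -!exprz_exp exprMz_comm ?unitrXz //; exact: mulrC.
Qed.

Lemma sign_expz (b : bool) (n : int) : exists b' : bool, ((-1) ^+ b : R) ^ n = (-1) ^+ b'.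
Proof.
case: b; last by exists false; rewrite expr0 exp1rz.
rewrite expr1; have H k : exists b' : bool, ((-1) : R) ^+ k = (-1) ^+ b'.
  by exists (odd k); rewrite signr_odd.
case: n => n; first exact: H.
have [b' Eb] := H n.+1; exists b'; rewrite NegzE -exprnN.
by rewrite Eb; case: (b'); rewrite ?expr1 ?expr0 ?invrN ?invr1.
Qed.

(** The parity relation, for vectors where the homomorphism is 1 or -1.  As the relation
    is twice a vector of the same kind, the product of the signs involved is 1. *)
Lemma parity_class (u1 v1 u2 v2 u3 v3 : int) (s1 s2 s3 : bool) :
  monom u1 v1 = (-1) ^+ s1 -> monom u2 v2 = (-1) ^+ s2 ->
  monom u3 v3 = (-1) ^+ s3 ->
  exists (b1 b2 b3 : bool) (p q : int) (s : bool), [/\ [|| b1, b2 | b3],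
    b1%:Z * u1 + b2%:Z * u2 + b3%:Z * u3 = 2 * p,
    b1%:Z * v1 + b2%:Z * v2 + b3%:Z * v3 = 2 * q,
    monom p q = (-1) ^+ s &
    (b1 && s1) (+) (b2 && s2) (+) (b3 && s3) = false].
Proof.
move=> M1 M2 M3.
have [b1 [b2 [b3 [k1 [k2 [k3 [bb Eu Ev]]]]]]] := parity_relation u1 v1 u2 v2 u3 v3.
exists b1, b2, b3, (k1 * u1 + k2 * u2 + k3 * u3), (k1 * v1 + k2 * v2 + k3 * v3).
have [t1 T1] := sign_expz s1 k1; have [t2 T2] := sign_expz s2 k2.
have [t3 T3] := sign_expz s3 k3.
have Ms : monom (k1 * u1 + k2 * u2 + k3 * u3) (k1 * v1 + k2 * v2 + k3 * v3)
    = (-1) ^+ (t1 (+) t2 (+) t3).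
  by rewrite !monomD !monomM M1 M2 M3 T1 T2 T3 !signr_addb.
exists (t1 (+) t2 (+) t3); split=> //.
have Mb (b s : bool) u v : monom u v = (-1) ^+ s ->
    monom (b%:Z * u) (b%:Z * v) = (-1) ^+ (b && s).
  by move=> Muv; rewrite monomM Muv; case: b; rewrite /= ?expr1z ?expr0z.
have : monom (b1%:Z * u1 + b2%:Z * u2 + b3%:Z * u3)
   (b1%:Z * v1 + b2%:Z * v2 + b3%:Z * v3) = 1.
  by rewrite Eu Ev monomM Ms -exprnP sqrr_sign.
rewrite !monomD (Mb _ _ _ _ M1) (Mb _ _ _ _ M2) (Mb _ _ _ _ M3) -!signr_addb.
by case: (_ (+) _) => //= /eqP; rewrite expr1 (negPf N1).
Qed.

End SignedPowers.

Section Classes.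
Variables (c d e : nat).
Hypotheses (c1 : (1 < c)%N) (oc : odd c) (cd : coprime c d) (ce : coprime c e).

Let g : int -> int -> 'Z_c := monom (d%:R : 'Z_c) e%:R.

Lemma Zp_unit_d : (d%:R : 'Z_c) \is a GRing.unit.
Proof. by rewrite unitZpE. Qed.

Lemma Zp_unit_e : (e%:R : 'Z_c) \is a GRing.unit.
Proof. by rewrite unitZpE. Qed.

Lemma Zp_eq0 n : (n%:R == 0 :> 'Z_c) = (c %| n)%N.
Proof. by rewrite -val_eqE /= val_Zp_nat. Qed.

Lemma Zp_N1_neq1 : (-1 : 'Z_c) != 1.
Proof.
rewrite eq_sym -subr_eq0 opprK -(natrD _ 1 1) Zp_eq0.
apply/negP => c2.
have c2' : c = 2%N by apply/eqP; rewrite eqn_leq c1 andbT dvdn_leq.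
by move: oc; rewrite c2'.
Qed.

Lemma monom_nat (x1 x2 y1 y2 : nat) :
  g (x1%:Z - y1%:Z) (x2%:Z - y2%:Z) * (d ^ y1 * e ^ y2)%N%:R = (d ^ x1 * e ^ x2)%N%:R.
Proof.
have H (k l : nat) : (d ^ k * e ^ l)%N%:R = g k l.
  by rewrite /g /monom natrM !natrX.
by rewrite !H -monomD ?Zp_unit_d ?Zp_unit_e // !subrK.
Qed.

Lemma monom_sol X Y z x1 x2 y1 y2 : (0 < z)%N -> sol_exps d e c X Y z x1 x2 y1 y2 ->
  g (x1%:Z - y1%:Z) (x2%:Z - y2%:Z) = (-1) ^+ true.
Proof.
move=> z0 [XY XE YE _ _]; have := monom_nat x1 x2 y1 y2; rewrite -XE -YE => gY.
have UY : (Y%:R : 'Z_c) \is a GRing.unit.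
  by rewrite unitZpE // YE coprimeMr !coprimeXr.
apply: (mulIr UY); rewrite gY expr1 mulN1r; apply/eqP.
by rewrite -subr_eq0 opprK -natrD Zp_eq0 XY -(prednK z0) expnS dvdn_mulr.
Qed.

(** With w + w' = 2 (p, q), the square root of X Y X' Y' is X X' / g (p, q), and g (p, q) is
    1 or -1. *)
Lemma same_class_of_sum X Y z x1 x2 y1 y2 X' Y' z' x1' x2' y1' y2' (p q : int) (s : bool) :
  sol_exps d e c X Y z x1 x2 y1 y2 -> sol_exps d e c X' Y' z' x1' x2' y1' y2' ->
  (x1%:Z - y1%:Z) + (x1'%:Z - y1'%:Z) = 2 * p ->
  (x2%:Z - y2%:Z) + (x2'%:Z - y2'%:Z) = 2 * q ->
  g p q = (-1) ^+ s -> same_class c X Y X' Y'.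
Proof.
move=> [_ XE YE _ _] [_ XE' YE' _ _] Ep Eq gpq.
have [A EA] : exists A : nat, A%:Z = x1%:Z + x1'%:Z - p.
  by exists `|(x1%:Z + x1'%:Z - p)%R|%N; clear -Ep; lia.
have [B EB] : exists B : nat, B%:Z = x2%:Z + x2'%:Z - q.
  by exists `|(x2%:Z + x2'%:Z - q)%R|%N; clear -Eq; lia.
exists (d ^ A * e ^ B)%N.
  have A2 : (A * 2 = x1 + x1' + (y1 + y1'))%N by clear -EA Ep; lia.
  have B2 : (B * 2 = x2 + x2' + (y2 + y2'))%N by clear -EB Eq; lia.
  by rewrite expnMn -!expnM A2 B2 XE YE XE' YE' !expnD; ring.
have key : g p q * (d ^ A * e ^ B)%N%:R = (X * X')%N%:R.
  have -> : (X * X')%N = (d ^ (x1 + x1') * e ^ (x2 + x2'))%N.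
    by rewrite XE XE' !expnD; ring.
  rewrite -(monom_nat (x1 + x1') (x2 + x2') A B); congr (g _ _ * _).
    by clear -EA; lia.
  by clear -EB; lia.
move: key; rewrite gpq; case: (s).
  rewrite expr1 mulN1r => /eqP; rewrite eq_sym -subr_eq0 opprK -natrD Zp_eq0 addnC.
  by left.
rewrite expr0 mul1r => /eqP; rewrite -val_eqE /= !val_Zp_nat // => /eqP H.
right; rewrite -eqz_mod_dvd !modz_nat H; exact: eqxx.
Qed.

(** Each solution has sign -1, so the parity relation involves exactly two of them. *)
Lemma same_class_pigeonhole X Y z x1 x2 y1 y2 X' Y' z' x1' x2' y1' y2'
    X'' Y'' z'' x1'' x2'' y1'' y2'' :
  (0 < z)%N -> (0 < z')%N -> (0 < z'')%N ->
  sol_exps d e c X Y z x1 x2 y1 y2 -> sol_exps d e c X' Y' z' x1' x2' y1' y2' ->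
  sol_exps d e c X'' Y'' z'' x1'' x2'' y1'' y2'' ->
  [\/ same_class c X Y X' Y', same_class c X Y X'' Y'' | same_class c X' Y' X'' Y''].
Proof.
move=> z0 z0' z0'' S S' S''.
have [b1 [b2 [b3 [p [q [s [bb Ep Eq gpq]]]]]]] := parity_class Zp_unit_d Zp_unit_e
  Zp_N1_neq1 (monom_sol z0 S) (monom_sol z0' S') (monom_sol z0'' S'').
case: b1 b2 b3 bb Ep Eq => [] [] [] //= _; rewrite ?mul1r ?mul0r ?addr0 ?add0r => Ep Eq _.
- by constructor 1; apply: same_class_of_sum S S' Ep Eq gpq.
- by constructor 2; apply: same_class_of_sum S S'' Ep Eq gpq.
- by constructor 3; apply: same_class_of_sum S' S'' Ep Eq gpq.
Qed.

(** A relation d ^ u * e ^ v = 1 that is not a square already names a nonzero element of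
    L / 2L where g is 1.  A solution that is not in the class of the given one is then in
    the class of the product of both, which determines the parity of its exponents. *)
Lemma parity_of_other_class X Y z x1 x2 y1 y2 X' Y' z' x1' x2' y1' y2' (u v : nat) :
  (0 < z)%N -> (0 < z')%N ->
  sol_exps d e c X Y z x1 x2 y1 y2 -> sol_exps d e c X' Y' z' x1' x2' y1' y2' ->
  (d ^ u * e ^ v = 1 %[mod c])%N -> odd u || odd v ->
  same_class c X Y X' Y' \/
  ~~ odd (x1 + y1 + u + (x1' + y1')) /\ ~~ odd (x2 + y2 + v + (x2' + y2')).
Proof.
move=> z0 z0' S S' E1 ouv.
have M2 : g u v = (-1) ^+ false.
  rewrite expr0 /g /monom -!exprnP -!natrX -natrM; apply: val_inj.
  by rewrite /= val_Zp_nat // E1 Zp_cast // modn_small // modn_small.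
have [b1 [b2 [b3 [p [q [s [bb Ep Eq gpq]]]]]]] := parity_class Zp_unit_d Zp_unit_e
  Zp_N1_neq1 (monom_sol z0 S) M2 (monom_sol z0' S').
case: b1 b2 b3 bb Ep Eq => [] [] [] //= _; rewrite ?mul1r ?mul0r ?addr0 ?add0r => Ep Eq _.
- by right; clear -Ep Eq; split; lia.
- by left; apply: same_class_of_sum S S' Ep Eq gpq.
- by exfalso; clear -Ep Eq ouv; lia.
Qed.
End Classes.
(** * Solutions in terms of the two bases *)

Section SolutionBasics.
Variables (d e c : nat).
Hypotheses (d1 : (1 < d)%N) (e1 : (1 < e)%N).

Lemma sol_exps_swap X Y z x1 x2 y1 y2 : sol_exps d e c X Y z x1 x2 y1 y2 ->
  sol_exps d e c Y X z y1 y2 x1 x2.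
Proof.
case=> XY XE YE [a b] [a' b'].
by split; rewrite ?[(Y + X)%N]addnC ?[(y1 + _)%N]addnC ?[(y2 + _)%N]addnC
  ?[(y1 * _)%N]mulnC ?[(y2 * _)%N]mulnC.
Qed.

Lemma sol_exps_swap_base X Y z x1 x2 y1 y2 : sol_exps d e c X Y z x1 x2 y1 y2 ->
  sol_exps e d c X Y z x2 x1 y2 y1.
Proof. by case=> XY XE YE A B; split; rewrite // mulnC. Qed.

Lemma sol_exps_mul X Y z x1 x2 y1 y2 : sol_exps d e c X Y z x1 x2 y1 y2 ->
  (X * Y = d ^ (x1 + y1) * e ^ (x2 + y2))%N.
Proof. by case=> _ -> -> _ _; rewrite !expnD; ring. Qed.

Lemma sol_exps_gt0 X Y z x1 x2 y1 y2 : sol_exps d e c X Y z x1 x2 y1 y2 ->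
  [/\ 0 < X, 0 < Y & 0 < z]%N.
Proof.
have d0 := ltnW d1; have e0 := ltnW e1; case=> XY XE YE _ _.
have X0 : (0 < X)%N by rewrite XE muln_gt0 !expn_gt0 d0 e0.
have Y0 : (0 < Y)%N by rewrite YE muln_gt0 !expn_gt0 d0 e0.
by split=> //; case: z XY => // XY; clear -X0 Y0 XY; lia.
Qed.

(** If neither X nor Y is 1, then each of them is a power of one base. *)
Lemma sol_exps_split X Y z x1 x2 y1 y2 : sol_exps d e c X Y z x1 x2 y1 y2 ->
  (1 < X)%N -> (1 < Y)%N ->
  [/\ x2 = 0, y1 = 0, 0 < x1, 0 < y2 & X = d ^ x1 /\ Y = e ^ y2]%N \/
  [/\ x1 = 0, y2 = 0, 0 < x2, 0 < y1 & X = e ^ x2 /\ Y = d ^ y1]%N.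
Proof.
case=> _ XE YE [p1 q1] [p2 q2] X1 Y1.
case: x1 y1 x2 y2 XE YE p1 q1 p2 q2 => [|x1] [|y1] [|x2] [|y2] XE YE //= p1 q1 p2 q2;
  rewrite ?expn0 ?mul1n ?muln1 in XE YE *; (by move: X1 Y1; rewrite ?XE ?YE) || by [left | right].
Qed.
End SolutionBasics.

Lemma same_class_doubled_or_tripled d e c X Y z x1 x2 y1 y2 X' Y' z' x1' x2' y1' y2' :
  (1 < d)%N -> (1 < e)%N -> (1 < c)%N -> odd c -> coprime c d -> coprime c e ->
  sol_exps d e c X Y z x1 x2 y1 y2 -> sol_exps d e c X' Y' z' x1' x2' y1' y2' ->
  same_class c X Y X' Y' -> (z <= z')%N ->
  [\/ (X * Y)%N = (X' * Y')%N /\ z = z', doubled X Y z (X' * Y') z'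
    | tripled X Y z (X' * Y') z'].
Proof.
move=> d1 e1 c1 oc cd ce S S' sc zz.
have [/andP[/eqP E1 /eqP E2]|/negP neq] :=
  boolP (((X * Y)%N == (X' * Y')%N) && (z == z')).
  by constructor 1.
have [X0 Y0 z0] := sol_exps_gt0 d1 e1 S; have [X0' Y0' _] := sol_exps_gt0 d1 e1 S'.
have [XY _ _ [a0 _] [b0 _]] := S; have [XY' _ _ [a0' _] [b0' _]] := S'.
have W := sol_exps_mul S; have W' := sol_exps_mul S'.
have cW : coprime c (X * Y) by rewrite W coprimeMr !coprimeXr.
have cW' : coprime c (X' * Y') by rewrite W' coprimeMr !coprimeXr.
have rad q : prime q -> (q %| X * Y)%N = (q %| X' * Y')%N.
  by move=> pq; rewrite W W' !Euclid_dvdM // !Euclid_dvdX // a0 b0 a0' b0' !andbT.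
have [|H|H] := same_class_powers c1 oc X0 Y0 X0' Y0' XY XY' z0 zz cW cW' sc rad.
- by case=> E1 E2; apply: neq; rewrite E1 E2 !eqxx.
- by constructor 2.
- by constructor 3.
Qed.

(** * The bases that admit two solutions of one class *)

(** The primes of d divide 3, so u is a power of 3; as 8 u + 3 is one too, u = 3. *)
Lemma tripled_powers (d e a b a' b' u k : nat) : (1 < d)%N -> (1 < e)%N ->
  (0 < a)%N -> (0 < b)%N -> (0 < u)%N -> (8 * u + 3 = 3 ^ k)%N ->
  (d ^ a = u)%N -> (e ^ b = (3 * u).+1)%N ->
  (d ^ a' * e ^ b' = (3 ^ k) ^ 2 * (d ^ a * e ^ b))%N ->
  [/\ d = 3, e = 10, u = 3 & k = 3]%N.
Proof.
move=> d1 e1 a0 b0 u0 uk dE eE W.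
have k2 : (1 < k)%N by case: k uk {W} => [|[|k]] //; rewrite ?expn0 ?expn1; clear -u0; lia.
have k9 : (3 ^ k = 9 * 3 ^ (k - 2))%N by rewrite -{1}(subnKC k2) expnD.
have u3 : (3 %| u)%N by move: uk; rewrite k9; clear; move: (3 ^ _)%N; lia.
have co3 : coprime e 3.
  rewrite -(coprime_pexpl _ _ b0) eE -addn1 mulnC coprime_sym.
  by rewrite /coprime gcdnMDl gcdn1.
have cod : coprime e d.
  rewrite -(coprime_pexpl _ _ b0) -(coprime_pexpr _ _ a0) eE dE -addn1 coprime_sym.
  by rewrite /coprime gcdnMDl gcdn1.
have Ed : (d ^ a' = (3 ^ k) ^ 2 * d ^ a)%N.
  by apply: mul_pow_cancel W; rewrite ?(ltnW d1) ?(ltnW e1) // !coprimeXr.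
have aa : (a < a')%N.
  rewrite -(ltn_exp2l _ _ d1) Ed; apply: ltn_Pmull; last by rewrite expn_gt0 ltnW.
  by rewrite -expnM -(expn0 3) ltn_exp2l // muln_gt0 ltnW.
have d3 q : prime q -> (q %| d)%N -> q = 3%N.
  move=> pq qd; have Ed' : (d ^ (a' - a) = (3 ^ k) ^ 2)%N.
    apply/eqP; rewrite -(@eqn_pmul2r (d ^ a)) ?expn_gt0 ?(ltnW d1) // -expnD.
    by rewrite subnK ?Ed // ltnW.
  have : (q %| (3 ^ k) ^ 2)%N by rewrite -Ed' dvdn_exp // subn_gt0.
  by rewrite -expnM Euclid_dvdX // dvdn_prime2 // => /andP[/eqP].
have [i di] := pow_only_prime_factor (ltnW d1) d3.
have ud : u = (3 ^ (i * a))%N by rewrite -dE di expnM.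
have ia1 : (i * a)%N = 1%N.
  have i0 : (0 < i)%N by case: i di {ud} => // di; rewrite di in d1.
  have : (0 < i * a)%N by rewrite muln_gt0 i0.
  move: ud; case: (i * a)%N => [|[|n]] // ud _; exfalso; move: uk.
  by rewrite ud !expnS k9; clear; move: (3 ^ n)%N (3 ^ _)%N; lia.
have u3' : u = 3%N by rewrite ud ia1.
have d3' : d = 3%N by move: ia1 di => /eqP; rewrite muln_eq1 => /andP[/eqP->].
have e10 : e = 10%N.
  move: eE; rewrite u3' => /(expn_eq_small e1 b0)[[]//|[n]]; clear -e1.
  have [e4|] := leqP 4 e; first by case: n => [|n]; nia.
  by case: e e1 => [|[|[|[|e]]]] // _ _; lia.
split=> //; move: uk; rewrite u3' /= => uk.
by apply/eqP; rewrite -(@eqn_exp2l 3) // -uk.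
Qed.

(** Every case where a class has two solutions is among these, up to an exchange of the
    bases. *)
Variant special_bases (d e c : nat) : Prop :=
| SpecialTripled of d = 3%N & e = 10%N & c = 13%N
| SpecialPlus h of e = 2%N \/ e = 4%N & (0 < h)%N & d = (2 ^ h).+1 & c = (2 ^ h.+1).+1
| SpecialMinus h of e = 2%N \/ e = 4%N & (1 < h)%N & d.+1 = (2 ^ h)%N & c.+1 = (2 ^ h.+1)%N
| SpecialSquareBase of d = 3%N & e = 2%N & c = 17%N
| SpecialSquareSum of d = 5%N & e = 2%N \/ e = 4%N & c = 3%N.

(** Comparing the powers of e gives 4 = e ^ n, so that e ^ b is a power 2 ^ h; then
    d ^ a = 2 ^ h + s and c ^ z = 2 ^ (h + 1) + s with s = 1 or -1. *)
Lemma doubled_powers (d e c a b a' b' z : nat) : (1 < d)%N -> (1 < e)%N -> (1 < c)%N ->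
  (0 < a)%N -> (0 < b)%N -> ~~ odd e -> (d ^ a + e ^ b = c ^ z)%N ->
  (d ^ a = (e ^ b).+1 \/ e ^ b = (d ^ a).+1)%N ->
  (d ^ a' * e ^ b' = 4 * (d ^ a * e ^ b))%N -> special_bases d e c.
Proof.
move=> d1 e1 c1 a0 b0 ee S consec W.
have d0 := ltnW d1; have e0 := ltnW e1.
have eeb : ~~ odd (e ^ b) by rewrite oddX negb_or ee -lt0n b0.
have ode : odd (d ^ a) by case: consec eeb => [->|->] //=; rewrite negbK.
have od : odd d by move: ode; rewrite oddX (gtn_eqF a0).
have de : coprime d e.
  rewrite -(coprime_pexpl _ _ a0) -(coprime_pexpr _ _ b0).
  by case: consec => ->; rewrite ?coprimeSn ?coprimenS.
have We : (e ^ b' = 4 * e ^ b)%N.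
  apply: (@mul_pow_cancel e d 4 b a b' a'); rewrite ?(coprimeXr 2 (coprimen2 d)) //.
    by rewrite (@coprimeXr 2 d 2) // coprimen2.
  by rewrite mulnC W; congr (_ * _)%N; rewrite mulnC.
have bb : (b < b')%N.
  rewrite -(ltn_exp2l _ _ e1) We; apply: ltn_Pmull => //.
  by rewrite expn_gt0 e0.
have e24 : e = 2%N \/ e = 4%N.
  have : (e ^ (b' - b) = 4)%N.
    apply/eqP; rewrite -(@eqn_pmul2r (e ^ b)) ?expn_gt0 ?e0 // -expnD.
    by rewrite subnK ?We // ltnW.
  have bb0 : (0 < b' - b)%N by rewrite subn_gt0.
  case/(expn_eq_small e1 bb0) => [[_ H]|[k H]]; [by right | left; move: H e1; clear].
  by case: e => [|[|[|e]]] // H _; case: k H => [|k]; nia.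
have [h [h0 eh hb]] : exists h, [/\ (0 < h)%N, (e ^ b = 2 ^ h)%N &
    e = 2%N \/ h = (2 * b)%N].
  case: e24 => eE; first by exists b; rewrite eE; split=> //; left.
  by exists (2 * b)%N; rewrite eE expnM; split; rewrite ?muln_gt0 //; right.
rewrite eh in S consec; have h2 : (2 ^ h.+1 = 2 ^ h + 2 ^ h)%N by rewrite expnS mul2n addnn.
case: consec => E.
  have cE : (c ^ z = (2 ^ h.+1).+1)%N by rewrite -S E h2.
  case: (pow2_succ_power d1 h0 E) => [a1|[d3 a2 h3]].
    case: (pow2_succ_power c1 (ltn0Sn h) cE) => [z1|[c3 z2 [h3]]].
      apply: (@SpecialPlus _ _ _ h) => //; first by rewrite -E a1 expn1.
      by rewrite -cE z1 expn1.
    by apply: SpecialSquareSum => //; move: E; rewrite a1 h3 expn1.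
  move: cE; rewrite h3 => /(expn_eq_prime c1 (isT : prime 17))[c17 _].
  apply: SpecialSquareBase => //; case: hb => // hb; exfalso.
  by move: hb; rewrite h3; clear; lia.
have a1 : a = 1%N by apply: (pow2_pred_power d1 a0 (esym E)).
have cE : ((c ^ z).+1 = 2 ^ h.+1)%N by rewrite -S h2 E -addSn -E.
have z0 : (0 < z)%N.
  have : (0 < d ^ a)%N by rewrite expn_gt0 d0.
  by case: z cE S => // _; rewrite E expn0; move: (d ^ a)%N => k; clear; lia.
have z1 : z = 1%N by apply: (pow2_pred_power c1 z0 cE).
apply: (@SpecialMinus _ _ _ h) => //; last by rewrite -cE z1 expn1.
  by case: h h0 E {cE S eh hb h2} => [|[|h]] // _; rewrite a1 expn1; clear -d1; lia.
by rewrite E a1 expn1.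
Qed.

Lemma sol_mul_ge4 d e c X Y z x1 x2 y1 y2 : (1 < d)%N -> (1 < e)%N ->
  sol_exps d e c X Y z x1 x2 y1 y2 -> (3 < X * Y)%N.
Proof.
move=> d1 e1 S; rewrite (sol_exps_mul S); case: S => _ _ _ [a0 _] [b0 _].
have A : (1 < d ^ (x1 + y1))%N by rewrite -(expn0 d) ltn_exp2l.
have B : (1 < e ^ (x2 + y2))%N by rewrite -(expn0 e) ltn_exp2l.
by apply: (leq_mul A B).
Qed.

Lemma doubled_special d e c X Y z x1 x2 y1 y2 X' Y' z' x1' x2' y1' y2' :
  (1 < d)%N -> (1 < e)%N -> (1 < c)%N ->
  sol_exps d e c X Y z x1 x2 y1 y2 -> sol_exps d e c X' Y' z' x1' x2' y1' y2' ->
  doubled X Y z (X' * Y') z' -> special_bases d e c \/ special_bases e d c.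
Proof.
move=> d1 e1 c1; wlog: X Y x1 x2 y1 y2 / (1 < X /\ 1 < Y /\ Y = X.+1)%N => [WL|].
  move=> S S' D; have W4 := sol_mul_ge4 d1 e1 S.
  have [_ _ consec] := D; case: consec => E.
    apply: (WL Y X y1 y2 x1 x2); [|exact: sol_exps_swap|exact: S'|].
      by move: W4; rewrite E; clear; case: (Y) => [|[|y]] //; lia.
    by case: D => H1 H2 _; split=> //; [rewrite H2 [(Y * X)%N]mulnC | right].
  apply: (WL X Y x1 x2 y1 y2) => //.
  by move: W4; rewrite E; clear; case: (X) => [|[|y]] //; lia.
case=> X1 [Y1 YX] S S' [_ WE _]; move: WE; rewrite (sol_exps_mul S').
move: (x1' + y1')%N (x2' + y2')%N => a' b' WE; have XY : (X + Y = c ^ z)%N by case: S.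
have parity (a b : nat) (P : Prop) : ((0 < a)%N -> (0 < b)%N -> odd X || odd Y ->
   ~~ (odd X && odd Y) -> P) -> (0 < a)%N -> (0 < b)%N -> P.
  by move=> H a0 b0; apply: H => //; rewrite YX /=; case: (odd X).
case: (sol_exps_split S X1 Y1) => [[_ _ a0 b0 [XE YE]]|[_ _ a0 b0 [XE YE]]].
  have [oe|ee] := boolP (odd e); [right | left].
    apply: (@doubled_powers e d c y2 x1 b' a' z) => //.
    - move: YX; rewrite XE YE => /(congr1 odd); rewrite /= !oddX oe orbT.
      by rewrite (gtn_eqF a0) /= => /esym.
    - by rewrite -XE -YE addnC.
    - by left; rewrite -XE -YE.
    - by rewrite mulnC WE XE YE; congr (_ * _)%N; rewrite mulnC.
  apply: (@doubled_powers d e c x1 y2 a' b' z) => //.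
  - by rewrite -XE -YE.
  - by right; rewrite -XE -YE.
  - by rewrite WE XE YE.
have [oe|ee] := boolP (odd e); [right | left].
  apply: (@doubled_powers e d c x2 y1 b' a' z) => //.
  - move: YX; rewrite XE YE => /(congr1 odd); rewrite /= !oddX oe orbT.
    by rewrite (gtn_eqF b0) /= => ->.
  - by rewrite -XE -YE.
  - by right; rewrite -XE -YE.
  - by rewrite mulnC WE XE YE.
apply: (@doubled_powers d e c y1 x2 a' b' z) => //.
- by rewrite -XE -YE addnC.
- by left; rewrite -XE -YE.
- by rewrite WE XE YE; congr (_ * _)%N; rewrite mulnC.
Qed.

Lemma tripled_special d e c X Y z x1 x2 y1 y2 X' Y' z' x1' x2' y1' y2' :
  (1 < d)%N -> (1 < e)%N -> (1 < c)%N ->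
  sol_exps d e c X Y z x1 x2 y1 y2 -> sol_exps d e c X' Y' z' x1' x2' y1' y2' ->
  tripled X Y z (X' * Y') z' ->
  [/\ c = 13, z = 1, X * Y = 30, z' = 3 & X' * Y' = 3 ^ 7 * 10]%N /\
  ((d = 3 /\ e = 10) \/ (d = 10 /\ e = 3))%N.
Proof.
move=> d1 e1 c1.
wlog: X Y x1 x2 y1 y2 / (exists u, X = u /\ Y = (3 * u).+1)%N => [WL|].
  move=> S S' [u [k [H1 H2 H3 H4 H5]]]; case: H5 => [H5|H5].
    apply: (WL X Y x1 x2 y1 y2) => //; first by exists u.
    by exists u, k; split=> //; left.
  rewrite [(X * Y)%N]mulnC; apply: (WL Y X y1 y2 x1 x2) => //; first by exists u.
    exact: sol_exps_swap.
  by exists u, k; split=> //; [rewrite [(Y * X)%N]mulnC | left].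
move=> [v [Xv Yv]] S S' [u [k [zE u0 uk WE XYu]]].
have {}XYu : X = u /\ Y = (3 * u).+1 by clear -Xv Yv XYu u0; lia.
case: XYu => XE YE {v Xv Yv}; have XY : (X + Y = c ^ z)%N by case: S.
have W' := sol_exps_mul S'.
have X1 : (1 < X)%N.
  rewrite XE; case: (u) u0 uk => [|[|n]] // _.
  by case: k {zE WE} => [|[|[|k]]] //; rewrite !expnS; clear; lia.
have Y1 : (1 < Y)%N by rewrite YE ltnS muln_gt0.
suff [dd [u3 k3]] : ((d = 3 /\ e = 10) \/ (d = 10 /\ e = 3))%N /\ u = 3%N /\ k = 3%N.
  have c13 : (c ^ z = 13)%N by rewrite -XY XE YE u3.
  have [-> z1] := expn_eq_prime c1 (isT : prime 13) c13.
  have W : (X * Y = 30)%N by rewrite XE YE u3.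
  by split=> //; split; rewrite ?zE ?z1 ?WE ?W ?k3.
move: WE; rewrite W'; move: (x1' + y1')%N (x2' + y2')%N => a' b' WE.
case: (sol_exps_split S X1 Y1) => [[_ _ a0 b0 [XE' YE']]|[_ _ a0 b0 [XE' YE']]].
  have [|||-> -> -> ->] := @tripled_powers d e x1 y2 a' b' u k d1 e1 a0 b0 u0 uk.
  - by rewrite -XE'.
  - by rewrite -YE'.
  - by rewrite WE XE' YE'.
  by split; [left|].
have [|||-> -> -> ->] := @tripled_powers e d x2 y1 b' a' u k e1 d1 a0 b0 u0 uk.
- by rewrite -XE'.
- by rewrite -YE'.
- by rewrite mulnC WE XE' YE'.
by split; [right|].
Qed.

(** * All solutions for the special bases *)

Lemma same_class_doubled d e c X Y z x1 x2 y1 y2 X' Y' z' x1' x2' y1' y2' :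
  (1 < d)%N -> (1 < e)%N -> (1 < c)%N -> odd c -> coprime c d -> coprime c e ->
  c <> 13%N ->
  sol_exps d e c X Y z x1 x2 y1 y2 -> sol_exps d e c X' Y' z' x1' x2' y1' y2' ->
  same_class c X Y X' Y' ->
  [\/ (X * Y)%N = (X' * Y')%N /\ z = z', doubled X Y z (X' * Y') z'
    | doubled X' Y' z' (X * Y) z].
Proof.
move=> d1 e1 c1 oc cd ce c13 S S' sc; have [zz|/ltnW zz] := leqP z z'.
  case: (same_class_doubled_or_tripled d1 e1 c1 oc cd ce S S' sc zz) => H.
  - by constructor 1.
  - by constructor 2.
  - by have [[]] := tripled_special d1 e1 c1 S S' H.
have sc' := same_class_sym sc.
case: (same_class_doubled_or_tripled d1 e1 c1 oc cd ce S' S sc' zz) => H.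
- by case: H => -> ->; constructor 1.
- by constructor 3.
- by have [[]] := tripled_special d1 e1 c1 S' S H.
Qed.

(** A solution other than the first two is in the class of 1 + 2 d = c, where nothing is
    a double. *)
Lemma solutions_minus d c h X Y z x1 x2 y1 y2 : (1 < h)%N ->
  (d.+1 = 2 ^ h)%N -> (c.+1 = 2 ^ h.+1)%N -> sol_exps d 2 c X Y z x1 x2 y1 y2 ->
  [\/ X * Y = d * 2 ^ h /\ z = 1, X * Y = 4 * (d * 2 ^ h) /\ z = 2
    | X * Y = 2 * d /\ z = 1]%N.
Proof.
move=> h1 dE cE S; have h4 : (2 ^ h = 4 * 2 ^ (h - 2))%N by rewrite -{1}(subnKC h1) expnD.
have H0 : (0 < 2 ^ (h - 2))%N by rewrite expn_gt0.
have cd2 : (c = (2 * d).+1)%N by move: cE; rewrite expnS -dE; clear; lia.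
have d3 : (2 < d)%N by clear -dE h4 H0; lia.
have c13 : c <> 13%N by clear -dE h4 cd2; lia.
have oc : odd c by rewrite cd2 /= oddM.
have c1 : (1 < c)%N by clear -cd2 d3; lia.
have cod : coprime c d by rewrite cd2 coprime_sym /coprime -addn1 gcdnMDl gcdn1.
have co2 : coprime c 2 by rewrite coprimen2.
have d1 := ltnW d3.
have S1 : sol_exps d 2 c d (2 ^ h) 1 1 0 0 h.
  by split; rewrite ?expn0 ?expn1 ?muln1 ?mul1n ?muln0 ?mul0n //;
    [rewrite cd2 -dE; clear; lia | split; rewrite // add0n ltnW].
have S3 : sol_exps d 2 c 1 (2 * d) 1 0 0 1 1.
  by split; rewrite ?expn0 ?expn1 ?muln1 ?mul1n ?cd2 ?add1n // mulnC.
have [_ _ z0] := sol_exps_gt0 d1 (isT : 1 < 2)%N S.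
have dbl := same_class_doubled d1 (isT : 1 < 2)%N c1 oc cod co2 c13.
case: (same_class_pigeonhole c1 oc cod co2 (ltn0Sn 0) (ltn0Sn 0) z0 S1 S3 S) => sc.
- case: (dbl _ _ _ _ _ _ _ _ _ _ _ _ _ _ S1 S3 sc) => [[E _]|[E _ _]|[E _ _]] //.
  by exfalso; move: E; rewrite -dE; clear -d3; nia.
- case: (dbl _ _ _ _ _ _ _ _ _ _ _ _ _ _ S1 S sc) => [[-> <-]|[-> -> _]|[zE _ _]].
  + by constructor 1.
  + by constructor 2.
  + by exfalso; clear -zE; lia.
- case: (dbl _ _ _ _ _ _ _ _ _ _ _ _ _ _ S3 S sc) => [[<- <-]|[_ _ E]|[zE _ _]].
  + by rewrite mul1n; constructor 3.
  + by exfalso; clear -E d3; lia.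
  + by exfalso; clear -zE; lia.
Qed.

Lemma solutions_3_2_5 X Y z x1 x2 y1 y2 : sol_exps 3 2 5 X Y z x1 x2 y1 y2 ->
  [\/ X * Y = 6 /\ z = 1, X * Y = 24 /\ z = 2 | X * Y = 144 /\ z = 2]%N.
Proof.
move=> S; have XY : (X + Y = 5 ^ z)%N by case: S.
have S1 : sol_exps 3 2 5 3 2 1 1 0 0 1 by split.
have S3 : sol_exps 3 2 5 9 16 2 2 0 0 4 by split.
have [_ _ z0] := sol_exps_gt0 (isT : 1 < 3)%N (isT : 1 < 2)%N S.
have c13 : 5%N <> 13%N by [].
have dbl := @same_class_doubled 3 2 5 _ _ _ _ _ _ _ _ _ _ _ _ _ _
  isT isT isT isT isT isT c13.
case: (@same_class_pigeonhole 5 3 2 isT isT isT isT _ _ _ _ _ _ _ _ _ _ _ _ _ _ _ _ _ _ _ _ _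
   (ltn0Sn 0) (ltn0Sn 1) z0 S1 S3 S) => sc.
- by case: (dbl _ _ _ _ _ _ _ _ _ _ _ _ _ _ S1 S3 sc) => [[]|[]|[]].
- case: (dbl _ _ _ _ _ _ _ _ _ _ _ _ _ _ S1 S sc) => [[<- <-]|[-> -> _]|[zE _ _]].
  + by constructor 1.
  + by constructor 2.
  + by exfalso; clear -zE; lia.
- case: (dbl _ _ _ _ _ _ _ _ _ _ _ _ _ _ S3 S sc) => [[<- <-]|[_ _ []]|[zE W E]] //.
  + by constructor 3.
  + exfalso; have z1 : z = 1%N by clear -zE; lia.
    move: XY; rewrite z1 expn1 => XY; case: E => E; rewrite E in XY W.
      have Y2 : Y = 2%N by clear -XY; lia.
      by rewrite Y2 in W.
    have X2 : X = 2%N by clear -XY; lia.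
    by rewrite X2 in W.
Qed.

Lemma solutions_5_2_3 X Y z x1 x2 y1 y2 : sol_exps 5 2 3 X Y z x1 x2 y1 y2 ->
  [\/ X * Y = 20 /\ z = 2, X * Y = 80 /\ z = 4 | X * Y = 50 /\ z = 3]%N.
Proof.
move=> S; have XY : (X + Y = 3 ^ z)%N by case: S.
have W4 := sol_mul_ge4 (isT : 1 < 5)%N (isT : 1 < 2)%N S.
have S1 : sol_exps 5 2 3 5 4 2 1 0 0 2 by split.
have S3 : sol_exps 5 2 3 25 2 3 2 0 0 1 by split.
have [_ _ z0] := sol_exps_gt0 (isT : 1 < 5)%N (isT : 1 < 2)%N S.
have c13 : 3%N <> 13%N by [].
have dbl := @same_class_doubled 5 2 3 _ _ _ _ _ _ _ _ _ _ _ _ _ _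
  isT isT isT isT isT isT c13.
case: (@same_class_pigeonhole 3 5 2 isT isT isT isT _ _ _ _ _ _ _ _ _ _ _ _ _ _ _ _ _ _ _ _ _
   (ltn0Sn 1) (ltn0Sn 2) z0 S1 S3 S) => sc.
- by case: (dbl _ _ _ _ _ _ _ _ _ _ _ _ _ _ S1 S3 sc) => [[]|[]|[]].
- case: (dbl _ _ _ _ _ _ _ _ _ _ _ _ _ _ S1 S sc) => [[<- <-]|[-> -> _]|[zE W E]].
  + by constructor 1.
  + by constructor 2.
  + exfalso; have z1 : z = 1%N by clear -zE; lia.
    move: XY; rewrite z1 expn1 => XY; case: E => E; rewrite E in XY W.
      have Y2 : Y = 1%N by clear -XY; lia.
      by rewrite Y2 in W.
    have X2 : X = 1%N by clear -XY; lia.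
    by rewrite X2 in W.
- case: (dbl _ _ _ _ _ _ _ _ _ _ _ _ _ _ S3 S sc) => [[<- <-]|[_ _ []]|[zE _ _]] //.
  + by constructor 3.
  + by exfalso; clear -zE; lia.
Qed.

Lemma sol_exps_type d e c X Y z x1 x2 y1 y2 : sol_exps d e c X Y z x1 x2 y1 y2 ->
  (c ^ z = (d ^ (x1 + y1) * e ^ (x2 + y2)).+1 \/
   c ^ z = d ^ (x1 + y1) + e ^ (x2 + y2))%N.
Proof.
case=> <- -> -> [_ /eqP] + [_ /eqP].
rewrite !muln_eq0 => /orP[] /eqP-> /orP[] /eqP->;
  rewrite ?addn0 ?add0n ?expn0 ?mul1n ?muln1.
- by left; rewrite add1n.
- by right; rewrite addnC.
- by right.
- by left; rewrite addn1.
Qed.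

Lemma sol_other_class d e c X Y z x1 x2 y1 y2 X' Y' z' x1' x2' y1' y2' (u v : nat) :
  (1 < d)%N -> (1 < e)%N -> (1 < c)%N -> odd c -> coprime c d -> coprime c e ->
  sol_exps d e c X Y z x1 x2 y1 y2 -> sol_exps d e c X' Y' z' x1' x2' y1' y2' ->
  (d ^ u * e ^ v = 1 %[mod c])%N -> odd u || odd v ->
  same_class c X Y X' Y' \/
  [/\ (0 < x1' + y1')%N, (0 < x2' + y2')%N, odd (x1' + y1') = odd (x1 + y1 + u)
    & odd (x2' + y2') = odd (x2 + y2 + v)].
Proof.
move=> d1 e1 c1 oc cd ce S S' E ouv.
have [_ _ z0] := sol_exps_gt0 d1 e1 S; have [_ _ z0'] := sol_exps_gt0 d1 e1 S'.
case: (parity_of_other_class c1 oc cd ce z0 z0' S S' E ouv); first by left.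
case=> H1 H2; right; have [_ _ _ [a0 _] [b0 _]] := S'.
by move: H1 H2; rewrite ![odd (_ + (_ + _))]oddD !negb_add => /eqP H1 /eqP H2; split.
Qed.

(** Outside the class of 9 + 8, both exponents are even; modulo 3, so is z, and the
    equation becomes one between squares. *)
Lemma solutions_3_2_17 X Y z x1 x2 y1 y2 : sol_exps 3 2 17 X Y z x1 x2 y1 y2 ->
  (X * Y = 72 /\ z = 1 \/ X * Y = 288 /\ z = 2)%N.
Proof.
move=> S; have S1 : sol_exps 3 2 17 9 8 1 2 0 0 3 by split.
have [_ _ z0] := sol_exps_gt0 (isT : 1 < 3)%N (isT : 1 < 2)%N S.
have [sc|] := @sol_other_class 3 2 17 _ _ _ _ _ _ _ _ _ _ _ _ _ _ 2 1
  isT isT isT isT isT isT S1 S erefl isT.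
  have c13 : 17%N <> 13%N by [].
  case: (@same_class_doubled 3 2 17 _ _ _ _ _ _ _ _ _ _ _ _ _ _
    isT isT isT isT isT isT c13 S1 S sc) => [[<- <-]|[-> -> _]|[zE _ _]].
  - by left.
  - by right.
  - by exfalso; clear -zE; lia.
move: (sol_exps_type S); move: (x1 + y1)%N (x2 + y2)%N => a b T [a0 b0 oa ob]; exfalso.
have aE : a = (a./2 * 2)%N by rewrite muln2 even_halfK // oa.
have bE : b = (b./2 * 2)%N by rewrite muln2 even_halfK // ob.
have m3 : (3 ^ a %% 3 = 0)%N by rewrite -(prednK a0) expnS modnMr.
have z2 : (17 ^ z %% 3 = 1)%N -> z = (z./2 * 2)%N.
  rewrite (@modn_expn_period 3 17 2) // modn2 => H.
  by rewrite muln2 even_halfK //; move: H; case: (odd z).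
case: T => T.
  have zE : z = (z./2 * 2)%N.
    by apply: z2; rewrite T -addn1 -modnDml -modnMml m3.
  move: T; rewrite zE aE bE !expnM -expnMn; set m := (_ * _)%N.
  have m0 : (0 < m)%N by rewrite muln_gt0 !expn_gt0.
  move: (17 ^ _)%N m m0 => n m; clear; rewrite -!mulnn => m0 E.
  have [nm|mn] := leqP n m; first by have := leq_mul nm nm; rewrite E ltnn.
  by have := leq_mul mn mn; rewrite E; clear -m0; nia.
have zE : z = (z./2 * 2)%N.
  apply: z2; rewrite T -modnDml m3 add0n (@modn_expn_period 3 2 2) // modn2.
  by rewrite ob.
move: T; rewrite zE {1}aE 2!expnM => /square_diff_pow2[||t [nE mE]].
- by rewrite oddX orbT.
- by rewrite oddX orbT.
have n8 : (17 ^ z./2 %% 8 = 1)%N by rewrite (@modn_expn_period 8 17 1) // modn1.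
have m8 : (3 ^ a./2 %% 8 = 1 \/ 3 ^ a./2 %% 8 = 3)%N.
  by rewrite (@modn_expn_period 8 3 2) // modn2; case: odd; [right | left].
by move: nE mE n8 m8; move: (17 ^ _)%N (3 ^ _)%N (2 ^ _)%N => n m k; clear; lia.
Qed.

(** Outside the class of 3 + 10, the exponent of 3 is even and that of 10 is odd.  This is
    impossible modulo 5, 7 and 13. *)
Lemma solutions_3_10_13 X Y z x1 x2 y1 y2 : sol_exps 3 10 13 X Y z x1 x2 y1 y2 ->
  (X * Y = 30 /\ z = 1 \/ X * Y = 3 ^ 7 * 10 /\ z = 3)%N.
Proof.
move=> S; have S1 : sol_exps 3 10 13 3 10 1 1 0 0 1 by split.
have [_ _ z0] := sol_exps_gt0 (isT : 1 < 3)%N (isT : 1 < 10)%N S.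
have [sc|] := @sol_other_class 3 10 13 _ _ _ _ _ _ _ _ _ _ _ _ _ _ 3 0
  isT isT isT isT isT isT S1 S erefl isT.
  case: (@same_class_doubled_or_tripled 3 10 13 _ _ _ _ _ _ _ _ _ _ _ _ _ _
    isT isT isT isT isT isT S1 S sc z0) => [[<- <-]|[_ _ []]|H] //.
  - by left.
  - by right; have [[_ _ _ -> ->] _] := @tripled_special 3 10 13 _ _ _ _ _ _ _
      _ _ _ _ _ _ _ isT isT isT S1 S H.
move: (sol_exps_type S); move: (x1 + y1)%N (x2 + y2)%N => a b T [a0 b0 oa ob]; exfalso.
have m5 : (10 ^ b %% 5 = 0)%N.
  by apply/eqP; rewrite -[_ == _]/(5 %| 10 ^ b)%N dvdn_exp.
case: T => T.
  have : (13 ^ z %% 5 = 1)%N by rewrite T -addn1 -modnDml -modnMmr m5 muln0.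
  rewrite (@modn_expn_period 5 13 4) // => z4.
  have {}z4 : (z %% 4 = 0)%N.
    by move: z4; have := ltn_pmod z (isT : 0 < 4)%N; case: (z %% 4)%N => [|[|[|[|]]]].
  have : (13 ^ z %% 7 = 1)%N by rewrite (@modn_expn_period 7 13 4) // z4.
  rewrite T => H; have : (7 %| 3 ^ a * 10 ^ b)%N.
    by move: H; move: (_ * _)%N => k; clear; lia.
  by rewrite Euclid_dvdM // !Euclid_dvdX.
have H5 : (13 ^ (z %% 4) = 3 ^ (a %% 4) %[mod 5])%N.
  by rewrite -!modn_expn_period // T -modnDmr m5 addn0.
have H7 : (13 ^ (z %% 2) = 3 ^ (a %% 6) + 10 ^ (b %% 6) %[mod 7])%N.
  by rewrite -modnDm -!modn_expn_period // modnDm -T.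
have H13 : (3 ^ (a %% 3) + 10 ^ (b %% 6) = 0 %[mod 13])%N.
  by rewrite -modnDm -!modn_expn_period // modnDm -T -(prednK z0) expnS modnMr.
have := ltn_pmod a (isT : 0 < 12)%N; have := ltn_pmod b (isT : 0 < 6)%N.
have := ltn_pmod z (isT : 0 < 4)%N.
rewrite -(modn_dvdm a (isT : 4 %| 12)%N) in H5.
rewrite -(modn_dvdm z (isT : 2 %| 4)%N) -(modn_dvdm a (isT : 6 %| 12)%N) in H7.
rewrite -(modn_dvdm a (isT : 3 %| 12)%N) in H13.
have {}oa : odd (a %% 12) = false.
  by move: oa; rewrite {1}(divn_eq a 12) oddD oddM andbF.
have {}ob : odd (b %% 6) = true.
  by move: ob; rewrite {1}(divn_eq b 6) oddD oddM andbF.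
move: (a %% 12)%N (b %% 6)%N (z %% 4)%N oa ob H5 H7 H13 => r s t or os H5 H7 H13 t4 s6 r12.
(* 12, 6 and 4 are periods of the powers of 3, 10 and 13 for the moduli in question. *)
have : all (fun r => all (fun s => all (fun t => [|| odd r, ~~ odd s,
     13 ^ t != 3 ^ (r %% 4) %[mod 5],
     13 ^ (t %% 2) != 3 ^ (r %% 6) + 10 ^ s %[mod 7] |
     3 ^ (r %% 3) + 10 ^ s != 0 %[mod 13]]) (iota 0 4)) (iota 0 6)) (iota 0 12).
  by vm_compute.
have inI n k : (k < n)%N -> k \in iota 0 n by rewrite mem_iota.
move/allP => /(_ r (inI _ _ r12)) /allP => /(_ s (inI _ _ s6)) /allP.
move=> /(_ t (inI _ _ t4)).
by rewrite or os H5 H7 H13 !eqxx.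
Qed.

(** Here c = -1 modulo d.  Outside the class of d + 2 ^ h the exponent a of d is even and
    that of 2 has the parity of h + 1.  For c ^ z = 1 + d ^ a * 2 ^ b this gives z = 2 k, and
    one of c ^ k - 1, c ^ k + 1 is prime to d, hence a power of 2.  For
    c ^ z = d ^ a + 2 ^ b it gives z even when h is odd, and a contradiction with h | b
    when h is even. *)
Lemma solutions_plus d c h X Y z x1 x2 y1 y2 : (1 < h)%N ->
  (d = (2 ^ h).+1)%N -> (c = (2 ^ h.+1).+1)%N -> sol_exps d 2 c X Y z x1 x2 y1 y2 ->
  (X * Y = d * 2 ^ h /\ z = 1 \/ X * Y = 4 * (d * 2 ^ h) /\ z = 2)%N.
Proof.
move=> h1 dE cE S; have h4 : (2 ^ h = 4 * 2 ^ (h - 2))%N by rewrite -{1}(subnKC h1) expnD.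
have H0 : (0 < 2 ^ (h - 2))%N by rewrite expn_gt0.
have h0 := ltnW h1.
have cd2 : (c.+1 = 2 * d)%N by rewrite cE dE expnS; clear; lia.
have d4 : (4 < d)%N by clear -dE h4 H0; lia.
have c13 : c <> 13%N by clear -dE h4 cd2; lia.
have od : odd d by rewrite dE /= oddX /= orbF -lt0n.
have oc : odd c by rewrite cE /= oddX.
have c1 : (1 < c)%N by clear -cd2 d4; lia.
have cod : coprime c d.
  have : coprime c.+1 c by rewrite coprimeSn.
  by rewrite cd2 coprimeMl => /andP[_]; rewrite coprime_sym.
have co2 : coprime c 2 by rewrite coprimen2.
have d1 : (1 < d)%N by clear -d4; lia.
have S1 : sol_exps d 2 c d (2 ^ h) 1 1 0 0 h.
  by split; rewrite ?expn0 ?expn1 ?muln1 ?mul1n ?muln0 ?mul0n //;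
    rewrite dE cE expnS; clear; lia.
have [_ _ z0] := sol_exps_gt0 d1 (isT : 1 < 2)%N S.
have e1 : (d ^ 1 * 2 ^ 1 = 1 %[mod c])%N.
  by rewrite !expn1 mulnC -cd2 -addn1 addnC modnDr.
have [sc|] := @sol_other_class _ _ _ _ _ _ _ _ _ _ _ _ _ _ _ _ _ 1 1
  d1 (isT : 1 < 2)%N c1 oc cod co2 S1 S e1 isT.
  case: (same_class_doubled d1 (isT : 1 < 2)%N c1 oc cod co2 c13 S1 S sc)
    => [[<- <-]|[-> -> _]|[zE _ _]]; [by left | by right |].
  by exfalso; clear -zE; lia.
move: (sol_exps_type S); move: (x1 + y1)%N (x2 + y2)%N => a b T [a0 b0 oa ob]; exfalso.
have aE : a = (a./2 * 2)%N by rewrite muln2 even_halfK // oa.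
have a20 : (0 < a./2)%N by move: aE a0; clear; case: (a./2) => // ->.
have cz n : (d%:Z %| (c ^ n)%N%:Z - (-1) ^+ n)%Z.
  rewrite PoszX subrXX dvdz_mulr // opprK.
  by apply/dvdzP; exists 2; rewrite -PoszM -cd2 -addn1 PoszD.
have dda : (d%:Z %| (d ^ a)%N%:Z)%Z by rewrite PoszX -(prednK a0) exprS dvdz_mulr.
case: T => T.
  have oz : odd z = false.
    apply/negP => oz; have := cz z; rewrite -signr_odd oz expr1 opprK T => H.
    have : (d%:Z %| 2)%Z.
      have -> : 2%:Z = (d ^ a * 2 ^ b).+1%:Z + 1 - (d ^ a)%N%:Z * (2 ^ b)%N%:Z.
        by rewrite -PoszM -addn1 PoszD; ring.
      by rewrite rpredB // dvdz_mulr.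
    by move/dvdn_leq; clear -d4; lia.
  have zE : z = (z./2 * 2)%N by rewrite muln2 even_halfK // oz.
  set k := z./2 in zE; have k0 : (0 < k)%N by move: zE z0; clear; case: (k) => // ->.
  have ck : (0 < c ^ k)%N by rewrite expn_gt0 ltnW.
  have F : ((c ^ k).-1 * (c ^ k).+1 = d ^ a * 2 ^ b)%N.
    move: T ck; rewrite zE expnM -mulnn; clear.
    by move: (c ^ k)%N (d ^ a * 2 ^ b)%N => [|n] m //=; nia.
  have := cz k; rewrite -signr_odd.
  have [ok|ek] := boolP (odd k); rewrite ?expr1 ?expr0 => dk.
    have cop : coprime (c ^ k).-1 d.
      apply: (coprime_of_dvd_shift2 od (m := (c ^ k).+1)).
        by move: dk; rewrite opprK -PoszD addn1.
      by right; clear -ck; lia.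
    have /(dvdn_pfactor _ _ (isT : prime 2))[j _ cj] : ((c ^ k).-1 %| 2 ^ b)%N.
      by rewrite -(@Gauss_dvdr _ (d ^ a)) ?coprimeXr // -F dvdn_mulr.
    have j0 : (0 < j)%N.
      case: j cj => // cj; have : odd (c ^ k) by rewrite oddX oc orbT.
      by rewrite -(prednK ck) cj.
    have ckj : (c ^ k = (2 ^ j).+1)%N by rewrite -cj prednK.
    have k1 : k = 1%N.
      case: (pow2_succ_power c1 j0 ckj) => // -[c3]; clear -c3 cd2 d4; lia.
    have F' : (2 ^ h.+2 = d ^ a.-1 * 2 ^ b)%N.
      apply/eqP; rewrite -(@eqn_pmul2l d) ?(ltnW d1) // mulnA -expnS prednK //.
      rewrite -F k1 expn1 cd2 cE /= !expnS; apply/eqP; clear; ring.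
    have : (d %| 2 ^ h.+2)%N.
      rewrite F' dvdn_mulr // dvdn_exp //.
      by move: aE a20; clear; case: (a./2) => // n ->; rewrite mulSn.
    by move/(odd_dvd_pow2 od) => dd; rewrite dd in d1.
  have cop : coprime (c ^ k).+1 d.
    apply: (coprime_of_dvd_shift2 od (m := (c ^ k).-1)).
      move: dk; have -> : (c ^ k)%N%:Z - 1 = (c ^ k).-1%:Z; last by [].
      by rewrite -{1}(prednK ck) -addn1 PoszD addrK.
    by left; clear -ck; lia.
  have /(dvdn_pfactor _ _ (isT : prime 2))[j _ cj] : ((c ^ k).+1 %| 2 ^ b)%N.
    by rewrite -(@Gauss_dvdr _ (d ^ a)) ?coprimeXr // -F dvdn_mull.
  by move: ek; rewrite (pow2_pred_power c1 k0 cj).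
have db : (d%:Z %| (2 ^ b)%N%:Z - (-1) ^+ z)%Z.
  have -> : (2 ^ b)%N%:Z - (-1) ^+ z = (c ^ z)%N%:Z - (-1) ^+ z - (d ^ a)%N%:Z.
    by rewrite T PoszD; ring.
  by rewrite rpredB.
have hb : (h %| b)%N.
  apply: (@pow2_mod_order h b ((-1) ^+ z)) => //; first by rewrite normrX normrN1 expr1n.
  by rewrite addn1 -dE.
have oh : odd h.
  have obh : odd b = ~~ odd h by rewrite ob add0n oddD addbT.
  by case/dvdnP: hb => q bE; move: obh; rewrite bE oddM; case: (odd h); rewrite ?andbF.
have oz : odd z = false.
  apply/negP => oz; have d3 : (3 %| d)%N.
    by rewrite /dvdn dE -addn1 -modnDml (@modn_expn_period 3 2 2) // modn2 oh.
  have : (3 %| (2 ^ b)%N%:Z + 1)%Z.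
    by move: db; rewrite -signr_odd oz expr1 opprK; apply: dvdz_trans.
  rewrite -PoszD dvdzE [absz _]/= /dvdn -modnDml.
  by rewrite (@modn_expn_period 3 2 2) // modn2 ob add0n oddD oh.
have zE : z = (z./2 * 2)%N by rewrite muln2 even_halfK // oz.
move: T; rewrite zE {1}aE 2!expnM => /square_diff_pow2[||t [nE mE]].
- by rewrite oddX od orbT.
- by rewrite oddX oc orbT.
have a1 := pow2_pred_power d1 a20 mE; move: mE; rewrite a1 expn1 dE h4.
by case: t {nE} => [|[|t]]; rewrite ?expnS; clear -H0; lia.
Qed.

(** * From integers and rational powers to natural numbers *)

Lemma card_le2 (T : Type) (A : set T) :
  (forall x y w, A x -> A y -> A w -> [\/ x = y, x = w | y = w]) -> A #<= `I_2.
Proof.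
move=> H; have img (x y : T) : A `<=` [set x; y] -> A #<= `I_2.
  move=> Axy; pose f n := if n is 0%N then x else y.
  apply: card_le_trans (card_image_le f `I_2); apply: subset_card_le.
  by move=> w /Axy [->|->]; [exists 0%N | exists 1%N].
have [[x Ax]|nA] := pselect (exists x, A x); last first.
  apply: (@card_le_trans _ _ _ (@set0 nat)); last by apply: subset_card_le.
  by apply/card_le0P/seteqP; split=> // w Aw; case: nA; exists w.
have [[y [Ay xy]]|nA] := pselect (exists y, A y /\ x <> y).
  apply: (img x y) => w Aw.
  by case: (H _ _ _ Ax Ay Aw) => [//|->|->]; [left | right].
apply: (img x x) => w Aw; left; apply: contrapT => wx.
by apply: nA; exists w; split=> // /esym.
Qed.

Lemma set3_card (T : Type) (x y w : T) : x <> y -> x <> w -> y <> w ->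
  [set x; y; w] #= `I_3.
Proof.
move=> xy xw yw; pose f n := match n with 0%N => x | 1%N => y | _ => w end.
have -> : [set x; y; w] = f @` `I_3.
  apply/seteqP; split=> [t [[->|->]|->]|t [[|[|[|n]]] //= _ <-]].
  - by exists 0%N.
  - by exists 1%N.
  - by exists 2%N.
  - by left; left.
  - by left; right.
  - by right.
apply: inj_card_eq => n m; rewrite !inE.
by case: n m => [|[|[|n]]] [|[|[|m]]] //= _ _ E; exfalso; first
  [exact: xy | exact: xw | exact: yw | exact: xy (esym E) | exact: xw (esym E) | exact: yw (esym E)].
Qed.

Lemma max_min_nat (x y : int) : 0 < Num.max x y /\ Num.min x y = 0 ->
  exists a b : nat, [/\ x = a%:Z, y = b%:Z & (0 < a + b)%N /\ (a * b = 0)%N].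
Proof.
rewrite maxEle minEle; case: (leP x y) => xy [p m].
  by exists 0%N, `|y|%N; split; [lia | lia | split; lia].
by exists `|x|%N, 0%N; split; [lia | lia | split; lia].
Qed.

Lemma nat_max_min (a b : nat) : (0 < a + b)%N /\ (a * b = 0)%N ->
  0 < Num.max a%:Z b%:Z /\ Num.min a%:Z b%:Z = 0.
Proof.
case=> ab /eqP; rewrite muln_eq0 => /orP[] /eqP E; rewrite E in ab *.
  by rewrite maxEle minEle lez_nat leq0n; split=> //; lia.
by rewrite maxEle minEle; case: ifP; lia.
Qed.

Lemma intr_monomial (d e a b : nat) :
  ((d ^ a * e ^ b)%N%:Z)%:~R = d%:Z%:~R ^ a%:Z * e%:Z%:~R ^ b%:Z :> rat.
Proof. by rewrite PoszM !PoszX intrM !rmorphXn. Qed.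

(** Negative exponents do not occur: the exponents of the
    bases are nonnegative because each minimum is 0, and z because X + Y is at least 2. *)
Lemma solutionsP (d e c : nat) (X Y z : int) : (1 < d)%N -> (1 < e)%N -> (1 < c)%N ->
  solutions d%:Z e%:Z c%:Z (X, Y, z) <->
  exists X' Y' z' x1 x2 y1 y2 : nat, [/\ (X, Y, z) = (X'%:Z, Y'%:Z, z'%:Z),
    sol_exps d e c X' Y' z' x1 x2 y1 y2 & (X' < Y')%N].
Proof.
move=> d1 e1 c1; have d0 := ltnW d1; have e0 := ltnW e1; split.
  case=> XY [i1 [j1 [i2 [j2 [XE YE]]]]].
  move=> /max_min_nat[x1 [y1 [ei1 ei2 h1]]] /max_min_nat[x2 [y2 [ej1 ej2 h2]]] XltY.
  rewrite ei1 ei2 ej1 ej2 -!intr_monomial in XE YE.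
  move/intr_inj: XE => XE; move/intr_inj: YE => YE.
  have X0 : (0 < d ^ x1 * e ^ x2)%N by rewrite muln_gt0 !expn_gt0 d0 e0.
  have Y0 : (0 < d ^ y1 * e ^ y2)%N by rewrite muln_gt0 !expn_gt0 d0 e0.
  case: z XY => [z|z] XY.
    exists (d ^ x1 * e ^ x2)%N, (d ^ y1 * e ^ y2)%N, z, x1, x2, y1, y2.
    split; [by rewrite XE YE | | by move: XltY; rewrite XE YE].
    split=> //; move: XY; rewrite XE YE -intrD -PoszD -exprnP -rmorphXn -PoszX.
    by move/intr_inj => [].
  exfalso; move: XY; rewrite XE YE -intrD NegzE -exprnN => XY.
  have : (d ^ x1 * e ^ x2 + d ^ y1 * e ^ y2)%N%:Z%:~R * c%:Z%:~R ^+ z.+1 = 1 :> rat.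
    rewrite PoszD XY mulVf // expf_neq0 // intr_eq0 eqz_nat.
    by rewrite -lt0n ltnW.
  rewrite -rmorphXn -PoszX -intrM -[1]/(1%:~R) => /intr_inj [] /eqP.
  rewrite muln_eq1 => /andP[/eqP E _]; clear -E X0 Y0; lia.
case=> X' [Y' [z' [x1 [x2 [y1 [y2 [[-> -> ->] S lt]]]]]]].
case: S => XY XE YE h1 h2; split=> //.
  by rewrite -intrD -PoszD XY PoszX rmorphXn.
exists x1%:Z, x2%:Z, y1%:Z, y2%:Z; split.
- by rewrite XE intr_monomial.
- by rewrite YE intr_monomial.
- exact: nat_max_min.
- exact: nat_max_min.
Qed.

Lemma sum_prod_unique (A B X Y : nat) : (X + Y = A + B)%N -> (X * Y = A * B)%N ->
  (X < Y)%N -> (A < B)%N -> X = A /\ Y = B.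
Proof.
move=> H1 H2 XY AB; have : (X%:Z - A%:Z) * (X%:Z - B%:Z) = 0.
  have -> : (X%:Z - A%:Z) * (X%:Z - B%:Z) = X%:Z ^+ 2 - X%:Z * (A%:Z + B%:Z) + (A%:Z * B%:Z).
    by ring.
  by rewrite -PoszD -H1 -[A%:Z * _]PoszM -H2 PoszM PoszD; ring.
move/eqP; rewrite mulf_eq0 => /orP[] /eqP E; clear H2; split; lia.
Qed.

Lemma sol_exps_unique d e c X Y z x1 x2 y1 y2 X' Y' z' x1' x2' y1' y2' :
  sol_exps d e c X Y z x1 x2 y1 y2 -> sol_exps d e c X' Y' z' x1' x2' y1' y2' ->
  (X < Y)%N -> (X' < Y')%N -> (X * Y)%N = (X' * Y')%N -> z = z' -> X = X' /\ Y = Y'.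
Proof.
case=> XY _ _ _ _ [XY' _ _ _ _] lt lt' W zz.
by apply: sum_prod_unique => //; rewrite XY XY' zz.
Qed.

Lemma sol_exps_base4 d c X Y z x1 x2 y1 y2 : sol_exps d 4 c X Y z x1 x2 y1 y2 ->
  sol_exps d 2 c X Y z x1 (2 * x2) y1 (2 * y2) /\ (4 %| X * Y)%N.
Proof.
move=> S; split.
  case: S => XY XE YE h1 [h2 h3]; split=> //; rewrite ?[(2 ^ (_ * _))%N]expnM //.
  by rewrite -mulnDr muln_gt0 h2 mulnACA h3 muln0.
rewrite (sol_exps_mul S); case: S => _ _ _ _ [h _].
by rewrite dvdn_mull // -(prednK h) expnS dvdn_mulr.
Qed.

(** * Counting the solutions *)

Lemma pow2_pred_int (d h : nat) : (d.+1 = 2 ^ h)%N -> 2 ^+ h - 1 = d%:Z.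
Proof.
by move=> dE; have := PoszX 2 h; rewrite -dE => <-; rewrite -addn1 PoszD addrK.
Qed.

Lemma solutions_eq_three (d e c A1 B1 z1 A2 B2 z2 A3 B3 z3 : nat) :
  (1 < d)%N -> (1 < e)%N -> (1 < c)%N ->
  (exists x1 x2 y1 y2, sol_exps d e c A1 B1 z1 x1 x2 y1 y2) ->
  (exists x1 x2 y1 y2, sol_exps d e c A2 B2 z2 x1 x2 y1 y2) ->
  (exists x1 x2 y1 y2, sol_exps d e c A3 B3 z3 x1 x2 y1 y2) ->
  (A1 < B1)%N -> (A2 < B2)%N -> (A3 < B3)%N ->
  (A1, z1) <> (A2, z2) -> (A1, z1) <> (A3, z3) -> (A2, z2) <> (A3, z3) ->
  (forall X Y z x1 x2 y1 y2, sol_exps d e c X Y z x1 x2 y1 y2 ->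
    [\/ X * Y = A1 * B1 /\ z = z1, X * Y = A2 * B2 /\ z = z2 | X * Y = A3 * B3 /\ z = z3]%N) ->
  solutions d%:Z e%:Z c%:Z #= `I_3 /\
  solutions d%:Z e%:Z c%:Z = [set (A1%:Z, B1%:Z, z1%:Z); (A2%:Z, B2%:Z, z2%:Z);
     (A3%:Z, B3%:Z, z3%:Z)].
Proof.
move=> d1 e1 c1 S1 S2 S3 l1 l2 l3 n12 n13 n23 cover.
have E : solutions d%:Z e%:Z c%:Z = [set (A1%:Z, B1%:Z, z1%:Z);
    (A2%:Z, B2%:Z, z2%:Z); (A3%:Z, B3%:Z, z3%:Z)].
  apply/seteqP; split=> [[[X Y] z]|t].
    case/(solutionsP _ _ _ d1 e1 c1) => X' [Y' [z' [x1 [x2 [y1 [y2 [-> S lt]]]]]]].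
    case: (cover _ _ _ _ _ _ _ S) => -[W zz].
    - have [a1 [a2 [b1 [b2 S']]]] := S1.
      have [-> ->] := sol_exps_unique S S' lt l1 W zz; rewrite zz; by left; left.
    - have [a1 [a2 [b1 [b2 S']]]] := S2.
      have [-> ->] := sol_exps_unique S S' lt l2 W zz; rewrite zz; by left; right.
    - have [a1 [a2 [b1 [b2 S']]]] := S3.
      have [-> ->] := sol_exps_unique S S' lt l3 W zz; rewrite zz; by right.
  have inS A B z : (exists x1 x2 y1 y2, sol_exps d e c A B z x1 x2 y1 y2) ->
      (A < B)%N -> solutions d%:Z e%:Z c%:Z (A%:Z, B%:Z, z%:Z).
    move=> [x1 [x2 [y1 [y2 S]]]] lt; apply/(solutionsP _ _ _ d1 e1 c1).
    by exists A, B, z, x1, x2, y1, y2.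
  by case=> [[->|->]|->]; apply: inS.
split=> //; rewrite E; apply: set3_card.
- by case=> hA _ hz; apply: n12; rewrite hA hz.
- by case=> hA _ hz; apply: n13; rewrite hA hz.
- by case=> hA _ hz; apply: n23; rewrite hA hz.
Qed.

(** With e = 4 the solutions are those for e = 2 whose product is divisible by 4; this
    removes one of the three solutions when e = 2 has three. *)
Lemma special_bases_at_most_two d e c : (1 < d)%N -> (1 < e)%N -> (1 < c)%N ->
  special_bases d e c -> ~ exceptional d%:Z e%:Z c%:Z ->
  exists W1 z1 W2 z2 : nat, forall X Y z x1 x2 y1 y2,
    sol_exps d e c X Y z x1 x2 y1 y2 ->
    (X * Y = W1 /\ z = z1 \/ X * Y = W2 /\ z = z2)%N.
Proof.
move=> d1 e1 c1 sp ne; case: sp d1 e1 c1 ne.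
- move=> -> -> -> _ _ _ _; exists 30%N, 1%N, (3 ^ 7 * 10)%N, 3%N => X Y z x1 x2 y1 y2.
  exact: solutions_3_10_13.
- move=> h e24 h0 dE cE d1 e1 c1 ne; have [h1|h1] := ltnP 1 h.
    exists (d * 2 ^ h)%N, 1%N, (4 * (d * 2 ^ h))%N, 2%N => X Y z x1 x2 y1 y2.
    case: e24 => ->; first exact: solutions_plus.
    by case/sol_exps_base4 => S _; apply: solutions_plus S.
  have hE : h = 1%N by apply/eqP; rewrite eqn_leq h1.
  rewrite hE in dE cE; rewrite {}dE {}cE in ne *.
  case: e24 => eE; rewrite {}eE in ne *; first by case: ne; constructor 1.
  (* 3 + 2 = 5 is lost when the base 2 is replaced by 4. *)
  exists 24%N, 2%N, 144%N, 2%N => X Y z x1 x2 y1 y2 /sol_exps_base4[S W4].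
  case: (solutions_3_2_5 S) => -[W zE]; [|by left|by right].
  by rewrite W in W4.
- move=> h e24 h1 dE cE d1 e1 c1 ne.
  case: e24 => eE; rewrite {}eE in ne *.
    case: ne; constructor 3; exists h.+1 => //.
    by rewrite subn1 [h.+1.-1]/= (pow2_pred_int dE) (pow2_pred_int cE).
  exists (d * 2 ^ h)%N, 1%N, (4 * (d * 2 ^ h))%N, 2%N => X Y z x1 x2 y1 y2.
  case/sol_exps_base4 => S W4.
  case: (solutions_minus h1 dE cE S) => -[W zE]; [by left | by right |].
  exfalso; move: W4; rewrite W (@dvdn_pmul2l 2 2) // => d2.
  have : odd d.+1 by rewrite /= -dvdn2 d2.
  by rewrite dE oddX orbF (gtn_eqF (ltnW h1)).
- move=> -> -> -> _ _ _ _; exists 72%N, 1%N, 288%N, 2%N => X Y z x1 x2 y1 y2.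
  exact: solutions_3_2_17.
- move=> -> e24 -> _ e1 _ ne; case: e24 => eE; rewrite {}eE in ne *.
    by case: ne; constructor 2.
  exists 20%N, 2%N, 80%N, 4%N => X Y z x1 x2 y1 y2 /sol_exps_base4[S W4].
  case: (solutions_5_2_3 S) => -[W zE]; [by left | by right |].
  by rewrite W in W4.
Qed.

Lemma same_class_special d e c X Y z x1 x2 y1 y2 X' Y' z' x1' x2' y1' y2' :
  (1 < d)%N -> (1 < e)%N -> (1 < c)%N -> odd c -> coprime c d -> coprime c e ->
  sol_exps d e c X Y z x1 x2 y1 y2 -> sol_exps d e c X' Y' z' x1' x2' y1' y2' ->
  same_class c X Y X' Y' -> ~ ((X * Y)%N = (X' * Y')%N /\ z = z') ->
  special_bases d e c \/ special_bases e d c.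
Proof.
move=> d1 e1 c1 oc cd ce.
wlog zz : X Y z x1 x2 y1 y2 X' Y' z' x1' x2' y1' y2' / (z <= z')%N => [WL|].
  move=> S S' sc neq; have [zz|/ltnW zz] := leqP z z'; first exact: (WL) S S' sc neq.
  apply: (WL) zz S' S (same_class_sym sc) _.
  by case=> hW hz; apply: neq.
move=> S S' sc neq.
case: (same_class_doubled_or_tripled d1 e1 c1 oc cd ce S S' sc zz) => // H.
  exact: doubled_special S S' H.
have [[cE _ _ _ _] de] := tripled_special d1 e1 c1 S S' H.
by case: de => -[dE eE]; [left | right]; constructor.
Qed.

Lemma at_most_two_solutions d e c X Y z x1 x2 y1 y2 X' Y' z' x1' x2' y1' y2'
    X'' Y'' z'' x1'' x2'' y1'' y2'' :
  (1 < d)%N -> (1 < e)%N -> (1 < c)%N -> odd c -> coprime c d -> coprime c e ->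
  ~ exceptional d%:Z e%:Z c%:Z -> ~ exceptional e%:Z d%:Z c%:Z ->
  sol_exps d e c X Y z x1 x2 y1 y2 -> sol_exps d e c X' Y' z' x1' x2' y1' y2' ->
  sol_exps d e c X'' Y'' z'' x1'' x2'' y1'' y2'' ->
  (X < Y)%N -> (X' < Y')%N -> (X'' < Y'')%N ->
  [\/ (X, Y, z) = (X', Y', z'), (X, Y, z) = (X'', Y'', z'')
    | (X', Y', z') = (X'', Y'', z'')].
Proof.
move=> d1 e1 c1 oc cd ce ne ne' S S' S'' lt lt' lt''.
pose R (X Y z X' Y' z' : nat) := (X * Y)%N = (X' * Y')%N /\ z = z'.
suff : [\/ R X Y z X' Y' z', R X Y z X'' Y'' z'' | R X' Y' z' X'' Y'' z''].
  case=> -[W zz]; [constructor 1 | constructor 2 | constructor 3]; rewrite zz.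
  - by have [-> ->] := sol_exps_unique S S' lt lt' W zz.
  - by have [-> ->] := sol_exps_unique S S'' lt lt'' W zz.
  - by have [-> ->] := sol_exps_unique S' S'' lt' lt'' W zz.
apply: contrapT => nR.
have n1 : ~ R X Y z X' Y' z' by move=> H; apply: nR; constructor 1.
have n2 : ~ R X Y z X'' Y'' z'' by move=> H; apply: nR; constructor 2.
have n3 : ~ R X' Y' z' X'' Y'' z'' by move=> H; apply: nR; constructor 3.
have sp : special_bases d e c \/ special_bases e d c.
  have [_ _ z0] := sol_exps_gt0 d1 e1 S; have [_ _ z0'] := sol_exps_gt0 d1 e1 S'.
  have [_ _ z0''] := sol_exps_gt0 d1 e1 S''.
  case: (same_class_pigeonhole c1 oc cd ce z0 z0' z0'' S S' S'') => sc.
  - exact: same_class_special S S' sc n1.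
  - exact: same_class_special S S'' sc n2.
  - exact: same_class_special S' S'' sc n3.
have [W1 [w1 [W2 [w2 H]]]] : exists W1 z1 W2 z2 : nat, forall X Y z x1 x2 y1 y2,
    sol_exps d e c X Y z x1 x2 y1 y2 ->
    (X * Y = W1 /\ z = z1 \/ X * Y = W2 /\ z = z2)%N.
  case: sp => sp; first exact: special_bases_at_most_two.
  have [W1 [w1 [W2 [w2 H]]]] := special_bases_at_most_two e1 d1 c1 sp ne'.
  exists W1, w1, W2, w2 => A B w a1 a2 b1 b2 T.
  exact: H (sol_exps_swap_base T).
case: (H _ _ _ _ _ _ _ S) (H _ _ _ _ _ _ _ S') (H _ _ _ _ _ _ _ S'')
  => -[A a] [] [A' a'] [] [A'' a''].
all: first [by apply: n1; split; congruence | by apply: n2; split; congruence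
  | by apply: n3; split; congruence].
Qed.

Theorem theorem2 :
  (forall c d1 d2 : int,
     1 < c -> 1 < d1 -> 1 < d2 ->
     odd `|c|%N -> coprimez d1 c -> coprimez d2 c ->
     ~ exceptional d1 d2 c -> ~ exceptional d2 d1 c ->
     solutions d1 d2 c #<= `I_2)
  /\ (solutions 3 2 5 #= `I_3 /\
      solutions 3 2 5 =
        [set (2, 3, 1); (1, 3 * 2 ^+ 3, 2); (3 ^+ 2, 2 ^+ 4, 2)])
  /\ (solutions 5 2 3 #= `I_3 /\
      solutions 5 2 3 =
        [set (2 ^+ 2, 5, 2); (1, 5 * 2 ^+ 4, 4); (2, 5 ^+ 2, 3)])
  /\ (forall g : nat, (2 < g)%N ->
      solutions (2 ^+ (g - 1) - 1) 2 (2 ^+ g - 1) #= `I_3 /\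
      solutions (2 ^+ (g - 1) - 1) 2 (2 ^+ g - 1) =
        [set (2 ^+ (g - 1) - 1, 2 ^+ (g - 1), 1);
             (1, 2 ^+ (g + 1) * (2 ^+ (g - 1) - 1), 2);
             (1, 2 * (2 ^+ (g - 1) - 1), 1)]).
Proof.
split; last split; last split.
- case=> // c [] // d [] // e c1 d1 e1 oc; rewrite !coprimezE /= => dc ec ne ne'.
  rewrite coprime_sym in dc; rewrite coprime_sym in ec.
  apply: card_le2 => -[[X Y] z] [[X' Y'] z'] [[X'' Y''] z''].
  case/(solutionsP _ _ _ d1 e1 c1) => A [B [w [a1 [a2 [b1 [b2 [-> S lt]]]]]]].
  case/(solutionsP _ _ _ d1 e1 c1) => A' [B' [w' [a1' [a2' [b1' [b2' [-> S' lt']]]]]]].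
  case/(solutionsP _ _ _ d1 e1 c1) => A'' [B'' [w'' [a1'' [a2'' [b1'' [b2'' [-> S'' lt'']]]]]]].
  have := at_most_two_solutions d1 e1 c1 oc dc ec ne ne' S S' S'' lt lt' lt''.
  by case=> -[-> -> ->]; [constructor 1 | constructor 2 | constructor 3].
- apply: (@solutions_eq_three 3 2 5 2 3 1 1 24 2 9 16 2) => //.
  + by exists 0%N, 1%N, 1%N, 0%N; split.
  + by exists 0%N, 0%N, 1%N, 3%N; split.
  + by exists 2%N, 0%N, 0%N, 4%N; split.
  + exact: solutions_3_2_5.
- apply: (@solutions_eq_three 5 2 3 4 5 2 1 80 4 2 25 3) => //.
  + by exists 0%N, 2%N, 1%N, 0%N; split.
  + by exists 0%N, 0%N, 1%N, 4%N; split.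
  + by exists 0%N, 1%N, 2%N, 0%N; split.
  + exact: solutions_5_2_3.
move=> g g2; have [h hE] : exists h, g = h.+1 by case: g g2 => // h _; exists h.
have h1 : (1 < h)%N by rewrite hE in g2.
rewrite hE subn1 /= addn1.
have h0 := ltnW h1.
have [d dE] : exists d, (d.+1 = 2 ^ h)%N.
  by exists (2 ^ h).-1; rewrite prednK // expn_gt0.
have [c cE] : exists c, (c.+1 = 2 ^ h.+1)%N.
  by exists (2 ^ h.+1).-1; rewrite prednK // expn_gt0.
have dZ := pow2_pred_int dE; have cZ := pow2_pred_int cE.
have cd : (c = (2 * d).+1)%N by move: cE; rewrite expnS -dE; clear; lia.
have d1 : (1 < d)%N.
  have : (2 ^ 2 <= 2 ^ h)%N by rewrite leq_exp2l.
  by rewrite -dE; clear; lia.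
have c1 : (1 < c)%N by rewrite cd; clear -d1; lia.
have pZ : 2 ^+ h = (2 ^ h)%N%:Z by rewrite PoszX.
have pdZ : 2 ^+ h.+2 * d%:Z = (2 ^ h.+2 * d)%N%:Z by rewrite PoszM PoszX.
rewrite dZ cZ pdZ pZ.
apply: (@solutions_eq_three d 2 c d (2 ^ h) 1 1 (2 ^ h.+2 * d) 2 1 (2 * d) 1) => //.
- exists 1%N, 0%N, 0%N, h; split; rewrite ?expn0 ?expn1 ?muln1 ?mul1n //.
  by rewrite -dE cd; clear; lia.
- exists 0%N, 0%N, 1%N, h.+2; split; rewrite ?expn0 ?expn1 ?muln1 //; last by rewrite mulnC.
  by rewrite !expnS -dE expn0 cd; clear; nia.
- exists 0%N, 0%N, 1%N, 1%N; split; rewrite ?expn0 ?expn1 ?muln1 ?cd //.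
  by rewrite mulnC.
- by rewrite -dE.
- by rewrite !expnS -dE; clear -d1; nia.
- by clear -d1; lia.
- by move=> /(congr1 fst) /= dd; rewrite dd in d1.
move=> X Y z x1 x2 y1 y2 S.
have E : (4 * (d * 2 ^ h) = 1 * (2 ^ h.+2 * d))%N by rewrite !expnS; clear; ring.
by rewrite -E mul1n; exact: solutions_minus S.
Qed.
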